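(* Let $n\ge 4$. The minimal orbits $\mathcal{O}'_{min}$ and $\mathcal{O}''_{min}$ are contained in the singular locus of the variety of reductions $Red(n)$.
   Context: Everything is over $\mathbb{C}$. $Red(n)$ is the Zariski closure, in the Grassmannian $G(n-1,\mathfrak{sl}_n)$ of $(n-1)$-dimensional linear subspaces of $\mathfrak{sl}_n$, of the set of Cartan subalgebras of $\mathfrak{sl}_n$ (the subalgebras of traceless matrices diagonal with respect to some basis of $\mathbb{C}^n$), with its reduced structure. For a linear subspace $V\subset\mathbb{C}^n$ let $\mathfrak{a}(V)=\{x\in\mathfrak{gl}_n : \mathrm{Im}(x)\subset V\subset \mathrm{Ker}(x)\}$. Then $\mathcal{O}'_{min}=\{\mathfrak{a}(V): \dim V=1\}\simeq\mathbb{P}^{n-1}$ and $\mathcal{O}''_{min}=\{\mathfrak{a}(V):\dim V=n-1\}\simeq\check{\mathbb{P}}^{n-1}$; these are closed $PGL_n$-orbits contained in $Red(n)$. *)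

(* Defs.v *)
From mathcomp Require Import all_boot all_order all_algebra.
From mathcomp Require Import mpoly.

Set Implicit Arguments.
Unset Strict Implicit.
Unset Printing Implicit Defensive.

Import GRing.Theory.
Local Open Scope ring_scope.

(** The Grassmannian G(k, U) of k-dimensional subspaces of U, in its Plücker
    embedding.  Its points are the subspaces of the ambient vector space
    themselves; homogeneous coordinates only enter through [plucker]. *)
Section Grassmannian.

Variables (F : fieldType) (vT : vectType F) (k : nat) (U : {vspace vT}).
Implicit Types (V : {vspace vT}) (X Y Z : {vspace vT} -> Prop).

Definition grassmannian V : Prop := (V <= U)%VS /\ \dim V = k.

Definition plucker_index : finType :=
  {f : {ffun 'I_k -> 'I_(\dim U)} |
    [forall i : 'I_k, forall j : 'I_k, (i < j)%N ==> (f i < f j)%N]}.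

Definition plucker_dim : nat := #|{: plucker_index}|.

(** The maximal minors of the matrix of a basis of V in a basis of U.  Another
    basis of V multiplies this vector by a nonzero scalar, and another basis
    of U changes it by a linear automorphism that does not depend on V. *)
Definition plucker V : 'rV[F]_plucker_dim :=
  \row_(c < plucker_dim) \det (\matrix_(i < k, j < k)
    coord (vbasis U) (val (enum_val c : plucker_index) j) (vbasis V)`_i).

Definition homogeneous (P : {mpoly F[plucker_dim]}) : Prop :=
  exists d, P \is d.-homog.

Definition vanishes_on X (P : {mpoly F[plucker_dim]}) : Prop :=
  forall V, X V -> P.@[plucker V 0] = 0.

Definition zariski_closed Z : Prop :=
  exists2 S : {mpoly F[plucker_dim]} -> Prop,
    forall P, S P -> homogeneous P &
    forall V, Z V <-> grassmannian V /\ forall P, S P -> P.@[plucker V 0] = 0.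

Definition included X Y : Prop := forall V, X V -> Y V.

Definition zariski_closure X V : Prop :=
  forall Z, zariski_closed Z -> included X Z -> Z V.

Definition zariski_irreducible Z : Prop :=
  (exists V, Z V) /\
  forall Y1 Y2, zariski_closed Y1 -> zariski_closed Y2 ->
    (forall V, Z V -> Y1 V \/ Y2 V) -> included Z Y1 \/ included Z Y2.

(** C_0, ..., C_m are irreducible closed subsets of X, each strictly contained
    in the next, and all contain p.  They correspond to chains of m + 1 prime
    ideals in the local ring of X at p. *)
Definition chain_at X p (m : nat) (C : nat -> {vspace vT} -> Prop) : Prop :=
  (forall i, (i <= m)%N ->
     [/\ zariski_closed (C i), zariski_irreducible (C i),
         included (C i) X & C i p]) /\
  (forall i, (i < m)%N -> included (C i) (C i.+1) /\ ~ included (C i.+1) (C i)).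

(** The Krull dimension of the local ring of X at p is d. *)
Definition local_dimension X p (d : nat) : Prop :=
  (exists C, chain_at X p d C) /\
  (forall m C, chain_at X p m C -> (m <= d)%N).

(** T is the tangent space, at the point [plucker p], to the affine cone over
    X with its reduced structure.  It contains the line spanned by
    [plucker p], and the quotient by this line is isomorphic to the Zariski
    tangent space of X at p; thus [\dim T] is one more than the dimension of
    the latter. *)
Definition cone_tangent_space X p (T : {vspace 'rV[F]_plucker_dim}) : Prop :=
  forall w, w \in T <->
    forall P, homogeneous P -> vanishes_on X P ->
      \sum_c (P^`M(c)).@[plucker p 0] * w 0 c = 0.

(** The local ring of X at p is not regular. *)
Definition singular_point X p : Prop :=
  X p /\
  exists d T, [/\ local_dimension X p d, cone_tangent_space X p T &
                  \dim T <> d.+1].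

End Grassmannian.

Section Reductions.

Variables (F : fieldType) (n : nat).
Implicit Types (A : {vspace 'M[F]_n}) (V : {vspace 'cV[F]_n}).

Definition sl : {vspace 'M[F]_n} := lker (linfun (@mxtrace F n : _ -> F^o)).

(** The columns of g are the basis in which the elements of A are diagonal. *)
Definition cartan A : Prop :=
  exists2 g : 'M[F]_n, g \in unitmx &
    forall x, x \in A <-> x \in sl /\ is_diag_mx (invmx g *m x *m g).

Definition Red : {vspace 'M[F]_n} -> Prop :=
  zariski_closure n.-1 sl cartan.

(** {x | Im x ⊂ V ⊂ Ker x}; see [mem_frak_a]. *)
Definition frak_a V : {vspace 'M[F]_n} :=
  ((\bigcap_(u <- vbasis {:'cV[F]_n}) (linfun (mulmxr u) @^-1: V)) :&:
   (\bigcap_(u <- vbasis V) lker (linfun (mulmxr u))))%VS.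

Lemma mem_sl x : (x \in sl) = (\tr x == 0).
Proof. by rewrite memv_ker lfunE. Qed.

Lemma mem_frak_a V x :
  x \in frak_a V <->
    (forall u : 'cV[F]_n, x *m u \in V) /\
    (forall u : 'cV[F]_n, u \in V -> x *m u = 0).
Proof.
have bigcapP (f : 'cV[F]_n -> {vspace 'M[F]_n}) (s : seq 'cV[F]_n) :
    x \in (\bigcap_(u <- s) f u)%VS <-> {in s, forall u, x \in f u}.
  elim: s => [|u s IHs]; first by rewrite big_nil memvf.
  rewrite big_cons memv_cap; split=> [/andP[xu /IHs xs] w|xs].
    by rewrite inE => /predU1P[->|/xs].
  by rewrite xs ?mem_head //=; apply/IHs=> w sw; rewrite xs // inE sw orbT.
rewrite memv_cap; split=> [/andP[/bigcapP im /bigcapP ker]|[im ker]].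
  split=> u => [|uV].
    rewrite (coord_vbasis (memvf u)) mulmx_sumr rpred_sum // => i _.
    rewrite -scalemxAr rpredZ //.
    have /im : (vbasis {:'cV[F]_n})`_i \in vbasis {:'cV[F]_n}.
      by rewrite mem_nth ?size_tuple.
    by rewrite -memv_preim lfunE.
  rewrite (coord_vbasis uV) mulmx_sumr big1 // => i _.
  have /ker : (vbasis V)`_i \in vbasis V by rewrite mem_nth ?size_tuple.
  by rewrite memv_ker lfunE /= -scalemxAr => /eqP ->; rewrite scaler0.
apply/andP; split; apply/bigcapP=> u su; first by rewrite -memv_preim lfunE /= im.
by rewrite memv_ker lfunE /= ker // vbasis_mem.
Qed.

Definition Omin' A : Prop := exists2 V, \dim V = 1 & A = frak_a V.

Definition Omin'' A : Prop := exists2 V, \dim V = n.-1 & A = frak_a V.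

Definition Sing_Red : {vspace 'M[F]_n} -> Prop :=
  singular_point n.-1 sl Red.

End Reductions.

(* Main.v *)
Require Import Defs.
From mathcomp Require Import all_boot all_order all_algebra.
From mathcomp Require Import perm mpoly.
From mathcomp Require Import ring zify.
From mathcomp Require Import boolp reals complex.

Set Implicit Arguments.
Unset Strict Implicit.
Unset Printing Implicit Defensive.

Import GRing.Theory Num.Theory.
Local Open Scope ring_scope.

(** Idea. [Red] is the closure of the cone of minors of the matrices
    [g E_i adj(g)] ([E_i] a basis of the traceless diagonal matrices), scaled by
    a parameter; so it is parametrised by N = n^2 + 1 polynomial variables.
    Along a chain C_0 < ... < C_l of irreducible closed subsets one multiplies
    by powers of forms vanishing on C_i but not on C_(i+1) and gets k^l
    polynomials of degree O(k) that are independent on C_l; pulled back to N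
    variables they lie in a space of dimension O(k^N), whence l <= N.

    On the other side, put m = n - 1 and let p be the span of the matrices
    E_(0,i), i >= 1, so that every point of [Omin'] is a conjugate of p and
    every point of [Omin''] a conjugate of its transpose.  If C^m carries a
    multiplication which is split (isomorphic to the product algebra C^m), with
    multiplication operators D_i, then for t <> 0 the matrices
    [[t a_i, e_i], [0, t (a_i + D_i)]], with a_i making the trace zero, are
    simultaneously diagonalisable.  Hence p lies in [Red] and (D_i) is a tangent
    direction.  The split multiplications span S^2(C^m)^* (x) C^m, so the
    tangent space to the cone has dimension at least 1 + m^2 (m + 1) / 2, which
    is larger than N + 1 for m >= 3. *)

(** * Multivariate polynomials *)

Section MultivariatePolynomials.

Variable F : numFieldType.

Lemma msize_mul_leq N d e (p q : {mpoly F[N]}) :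
  (msize p <= d.+1 -> msize q <= e.+1 -> msize (p * q) <= (d + e).+1)%N.
Proof.
move=> hp hq; have [->|p0] := eqVneq p 0; first by rewrite mul0r msize0.
have [->|q0] := eqVneq q 0; first by rewrite mulr0 msize0.
rewrite msizeM // -ltnS prednK; last first.
  by rewrite addn_gt0 lt0n msize_poly_eq0 p0.
by rewrite -addSn -addnS leq_add.
Qed.

Lemma msize_exp_leq N d k (p : {mpoly F[N]}) :
  (msize p <= d.+1 -> msize (p ^+ k) <= (k * d).+1)%N.
Proof.
move=> hp; elim: k => [|k IHk]; first by rewrite expr0 msize1.
by rewrite exprS mulSn msize_mul_leq.
Qed.

Lemma msize_comp_leq N k d e (w : k.-tuple {mpoly F[N]}) (p : {mpoly F[k]}) :
  (forall i, msize (tnth w i) <= e.+1)%N -> (msize p <= d.+1)%N ->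
  (msize (p \mPo w) <= (d * e).+1)%N.
Proof.
move=> hw hp; rewrite comp_mpolyEX; apply: leq_trans (msize_sum _ _ _) _.
apply/bigmax_leqP_seq => m pm _; apply: leq_trans (msizeZ_le _ _) _.
have: (mdeg m <= d)%N by rewrite -ltnS (leq_trans (msize_mdeg_lt pm)).
rewrite comp_mpolyX => hm.
apply: (@leq_trans (mdeg m * e).+1); last by rewrite ltnS leq_mul2r hm orbT.
rewrite mdegE big_distrl /=.
elim/big_rec2: _ => [|i s q _ IH]; first by rewrite msize1.
by apply: msize_mul_leq => //; apply: msize_exp_leq.
Qed.

(** In a monomial of degree less than [D] every exponent is less than [D], so at most [D ^ N]
    monomials occur; the coefficient matrix [A] has independent rows and that many columns. *)
Lemma card_free_mpoly N D (T : finType) (b : T -> {mpoly F[N]}) :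
  (forall t, (msize (b t) <= D)%N) ->
  (forall c : T -> F, \sum_t c t *: b t = 0 -> forall t, c t = 0) ->
  (#|T| <= D ^ N)%N.
Proof.
move=> hD free_b.
pose mon (f : {ffun 'I_N -> 'I_D}) : 'X_{1..N} := [multinom f i : nat | i < N].
pose A := \matrix_(t < #|T|, f < #|{ffun 'I_N -> 'I_D}|)
   (b (enum_val t))@_(mon (enum_val f)).
have freeA : row_free A.
  apply: inj_row_free => v vA0.
  have c0 : \sum_t v 0 (enum_rank t) *: b t = 0.
    apply/mpolyP=> m; rewrite mcoeff0 raddf_sum /=.
    have [/forallP hm|] := boolP [forall i, m i < D]%N; last first.
      case/forallPn=> i; rewrite -leqNgt => him.
      rewrite big1 // => t _; rewrite mcoeffZ memN_msupp_eq0 ?mulr0 //.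
      apply: msize_mdeg_ge; apply: leq_trans (hD t) (leq_trans him _).
      by rewrite mdegE (bigD1 i) //= leq_addr.
    have -> : m = mon [ffun i => Ordinal (hm i)].
      by apply/mnmP=> i; rewrite mnmE ffunE.
    set f := [ffun _ => _].
    have : (v *m A) 0 (enum_rank f) = 0 by rewrite vA0 mxE.
    rewrite mxE => vAf; apply: etrans vAf.
    rewrite (reindex (fun t : 'I_#|T| => enum_val t)) /=; last first.
      by exists enum_rank => t _; rewrite ?enum_valK ?enum_rankK.
    by apply: eq_bigr => t _; rewrite mcoeffZ !mxE !enum_valK enum_rankK.
  apply/rowP=> t; rewrite mxE -(enum_valK t).
  exact: (free_b (fun t => v 0 (enum_rank t))).
have := rank_leq_col A; rewrite (eqP freeA) => /leq_trans; apply.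
by rewrite card_ffun !card_ord.
Qed.

Lemma dhomog_meval_scale N d (p : {mpoly F[N]}) a (v : 'I_N -> F) :
  p \is d.-homog -> p.@[fun i => a * v i] = a ^+ d * p.@[v].
Proof.
move=> /dhomogP hp; rewrite !mevalE mulr_sumr big_seq [RHS]big_seq.
apply: eq_bigr => m pm; rewrite mulrCA; congr (_ * _).
have <- : mdeg m = d := hp m pm.
rewrite mdegE -prodrXr -big_split /=.
by apply: eq_bigr => i _; rewrite exprMn.
Qed.

Lemma horner_mmap N (u : 'I_N -> {poly F}) (p : {mpoly F[N]}) t :
  (mmap polyC u p).[t] = p.@[fun c => (u c).[t]].
Proof.
rewrite /mmap mevalE -horner_evalE rmorph_sum; apply: eq_bigr => m _ /=.
rewrite horner_evalE hornerM hornerC; congr (_ * _).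
rewrite /mmap1 -horner_evalE rmorph_prod; apply: eq_bigr => i _ /=.
by rewrite rmorphXn /= horner_evalE.
Qed.

Lemma deriv_mmap N (u : 'I_N -> {poly F}) (p : {mpoly F[N]}) :
  (mmap polyC u p)^`() = \sum_c mmap polyC u p^`M(c) * (u c)^`().
Proof.
pose D q := (mmap polyC u q)^`() = \sum_c mmap polyC u q^`M(c) * (u c)^`().
have DC c : D c%:MP.
  rewrite /D mmapC derivC big1 // => i _.
  by rewrite mderivC mmap0 mul0r.
have DM q r : D q -> D r -> D (q * r).
  rewrite /D => hq hr; rewrite rmorphM derivM hq hr mulr_suml mulr_sumr -big_split.
  apply: eq_bigr => c _; rewrite mderivM raddfD /= !rmorphM /= mulrDl.
  by congr (_ + _); rewrite ?mulrA // mulrAC.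
have DX i : D 'X_i.
  rewrite /D mmapX mmap1U (bigD1 i) //= big1 ?addr0 => [|j ji].
    rewrite mderivX mnm1E eqxx scale1r.
    have -> : (U_(i) - U_(i))%MM = 0%MM :> 'X_{1..N}.
      by apply/mnmP=> j; rewrite mnmBE subnn mnm0E.
    by rewrite mpolyX0 rmorph1 mul1r.
  by rewrite mderivX mnm1E eq_sym (negPf ji) scale0r mmap0 mul0r.
have Dexp q k : D q -> D (q ^+ k).
  move=> hq; elim: k => [|k IHk]; first by rewrite expr0 -mpolyC1; apply: DC.
  by rewrite exprS; apply: DM.
suff: D p by [].
elim/mpolyind: p => [|c m p _ _ IHp]; first by rewrite -(mpolyC0 N F); apply: DC.
have Dm : D 'X_[m].
  rewrite mpolyXE_id; elim/big_rec: _ => [|i q _ hq].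
    by rewrite -mpolyC1; apply: DC.
  by apply: DM => //; apply: Dexp.
have {}Dm : D (c *: 'X_[m]) by rewrite -mul_mpolyC; apply: DM.
rewrite /D raddfD derivD Dm IHp -big_split /=.
by apply: eq_bigr => i _; rewrite mderivD raddfD /= mulrDl.
Qed.

Lemma poly_eq0_horner (q : {poly F}) :
  (forall t, t != 0 -> q.[t] = 0) -> q = 0.
Proof.
(* In characteristic 0 the numbers 1, ..., [size q] are distinct nonzero roots, more than the degree
   allows. *)
move=> hq; pose rs := [seq i.+1%:R : F | i <- iota 0 (size q)].
apply: (@roots_geq_poly_eq0 _ _ rs).
- apply/allP=> _ /mapP[i _ ->]; rewrite /root hq //.
  by rewrite pnatr_eq0.
- by rewrite map_inj_uniq ?iota_uniq // => i j /eqP; rewrite eqr_nat => /eqP[].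
- by rewrite size_map size_iota.
Qed.

(** Substituting the curve gives a one-variable polynomial vanishing at every t <> 0, hence zero;
    its value at 0 vanishes, and so does its derivative, given by the chain rule [deriv_mmap]. *)
Lemma vanish_curve N (u : 'I_N -> {poly F}) (p : {mpoly F[N]}) :
  (forall t, t != 0 -> p.@[fun c => (u c).[t]] = 0) ->
  p.@[fun c => (u c).[0]] = 0 /\
  \sum_c p^`M(c).@[fun c => (u c).[0]] * (u c)^`().[0] = 0.
Proof.
move=> hp; have q0 : mmap polyC u p = 0.
  by apply: poly_eq0_horner => t t0; rewrite horner_mmap hp.
split; first by rewrite -horner_mmap q0 horner0.
have := congr1 (fun q => q.[0]) (deriv_mmap u p).
rewrite /= q0 deriv0 horner0 horner_sum => /esym sum0; apply: etrans sum0.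
by apply: eq_bigr => c _; rewrite hornerM horner_mmap.
Qed.

Lemma meval_scale_pihomog N (p : {mpoly F[N]}) a (v : 'I_N -> F) :
  p.@[fun i => a * v i] =
  (\poly_(d < msize p) (pihomog mdeg d p).@[v]).[a].
Proof.
rewrite {1}(pihomog_partitionE (leqnn (msize p))) raddf_sum horner_poly /=.
apply: eq_bigr => d _; rewrite mulrC.
by apply: dhomog_meval_scale; apply: pihomogP.
Qed.

(** Along the line through [v], [p] becomes a polynomial in [a] whose coefficients are the values at
    [v] of its homogeneous components. *)
Lemma meval_cone0 N (p : {mpoly F[N]}) (v : 'I_N -> F) :
  (forall a, p.@[fun i => a * v i] = 0) <->
  (forall d, (pihomog mdeg d p).@[v] = 0).
Proof.
split=> [hp d|hp a]; last first.
  rewrite meval_scale_pihomog; set q := \poly_(_ < _) _.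
  suff -> : q = 0 by rewrite horner0.
  by apply/polyP=> i; rewrite coef_poly coef0 hp if_same.
have [dp|pd] := ltnP d (msize p); last first.
  have -> : pihomog mdeg d p = 0; last by rewrite meval0.
  rewrite pihomogE big_seq_cond big_pred0 // => m; apply/negP => /andP[pm /eqP md].
  by have := msize_mdeg_lt pm; rewrite md ltnNge pd.
have /polyP/(_ d) : \poly_(d < msize p) (pihomog mdeg d p).@[v] = 0.
  by apply: poly_eq0_horner => t _; rewrite -meval_scale_pihomog.
by rewrite coef_poly dp coef0.
Qed.

End MultivariatePolynomials.

Lemma leq_expn_growth E m N :
  (forall k, k ^ m <= (E * k).+1 ^ N)%N -> (m <= N)%N.
Proof.
move=> hk; rewrite leqNgt; apply/negP => Nm.
(* If N < m, this [k] gives (E k + 1)^N <= (E + 1)^N k^N < k^(N + 1) <= k^m, against the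
   hypothesis. *)
pose k := (E.+1 ^ N).+1; have := hk k; apply/negP; rewrite -ltnNge.
apply: (@leq_ltn_trans ((E.+1 * k) ^ N)%N).
  have [->|N0] := posnP N; first by rewrite !expn0.
  by rewrite leq_exp2r // mulSn -add1n leq_add2r.
rewrite expnMn; apply: (@leq_trans (k * k ^ N)%N).
  by rewrite ltn_mul2r expn_gt0 /= /k leqnn.
by rewrite -expnS leq_pexp2l.
Qed.

(** * Chains of closed subsets and tangent vectors *)

Section ZariskiTopology.

Variables (F : numFieldType) (vT : vectType F) (k : nat) (U : {vspace vT}).
Implicit Types (V : {vspace vT}) (X Y Z : {vspace vT} -> Prop).

Local Notation D := (plucker_dim k U).
Local Notation pl := (plucker k U).

(* P need not be homogeneous: it vanishes on the affine cone over X. *)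
Definition cone_vanishes X (P : {mpoly F[D]}) : Prop :=
  forall V, X V -> forall a, P.@[fun c => a * pl V 0 c] = 0.

Lemma cone_vanishesD X P Q :
  cone_vanishes X P -> cone_vanishes X Q -> cone_vanishes X (P + Q).
Proof. by move=> hP hQ V XV a; rewrite mevalD hP // hQ // addr0. Qed.

Lemma cone_vanishesMl X P Q : cone_vanishes X Q -> cone_vanishes X (P * Q).
Proof. by move=> hQ V XV a; rewrite mevalM hQ // mulr0. Qed.

Lemma cone_vanishesN X P : cone_vanishes X P -> cone_vanishes X (- P).
Proof. by move=> hP V XV a; rewrite mevalN hP // oppr0. Qed.

Lemma cone_vanishes_included X Y P :
  included X Y -> cone_vanishes Y P -> cone_vanishes X P.
Proof. by move=> XY hP V XV; apply: hP; apply: XY. Qed.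

Lemma zariski_closed_cone P :
  zariski_closed k U (fun V => grassmannian k U V /\
    forall a, P.@[fun c => a * pl V 0 c] = 0).
Proof.
exists (fun Q => exists d, Q = pihomog mdeg d P).
  by move=> _ [d ->]; exists d; apply: pihomogP.
move=> V; split=> -[gV hV]; split=> //.
  by move=> _ [d ->]; apply/(meval_cone0 _ _).1.
by apply/meval_cone0 => d; apply: hV; exists d.
Qed.

Lemma zariski_closed_grassmannian Z :
  zariski_closed k U Z -> included Z (grassmannian k U).
Proof. by case=> S _ hZ V /hZ[]. Qed.

Lemma included_zariski_closure X : included X (zariski_closure k U X).
Proof. by move=> V XV Z _; apply. Qed.

Lemma cone_vanishes_closure X P : included X (grassmannian k U) ->
  cone_vanishes X P -> cone_vanishes (zariski_closure k U X) P.
Proof.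
move=> gX hP V /(_ _ (zariski_closed_cone P))[|//] W XW.
by split; [apply: gX|apply: hP].
Qed.

Lemma meval_line_eq0 N (P : {mpoly F[N]}) (v : 'I_N -> F) :
  (forall a, P.@[fun i => a * v i] = 0) <->
  mmap polyC (fun i => v i *: 'X) P = 0.
Proof.
have hornerP a : (mmap polyC (fun i => v i *: 'X) P).[a] =
    P.@[fun i => a * v i].
  rewrite horner_mmap; apply: meval_eq => i.
  by rewrite hornerZ hornerX mulrC.
split=> [hP|P0 a]; last by rewrite -hornerP P0 horner0.
by apply: poly_eq0_horner => a _; rewrite hornerP.
Qed.

(** Restricted to a line of the cone, the product lies in the domain F[X], so one factor vanishes on
    the whole line. Thus two closed sets cover [Z], and irreducibility selects one. *)
Lemma cone_vanishes_prime Z P Q : included Z (grassmannian k U) ->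
  zariski_irreducible k U Z -> cone_vanishes Z (P * Q) ->
  cone_vanishes Z P \/ cone_vanishes Z Q.
Proof.
move=> gZ [_ irrZ] hPQ.
have := irrZ _ _ (zariski_closed_cone P) (zariski_closed_cone Q).
case=> [V ZV|ZP|ZQ]; last 2 first.
- by left=> V /ZP[].
- by right=> V /ZQ[].
have := (meval_line_eq0 _ _).1 (hPQ V ZV); rewrite rmorphM /=.
move/eqP; rewrite mulf_eq0 => /orP[] /eqP/meval_line_eq0 h; [left|right];
  by split=> //; apply: gZ.
Qed.

Lemma cone_vanishes_separates Z Y : zariski_closed k U Z ->
  included Y (grassmannian k U) -> ~ included Y Z ->
  exists2 P, cone_vanishes Z P & ~ cone_vanishes Y P.
Proof.
case=> S homS hZ gY YZ; apply: contrapT => noP; apply: YZ => V YV.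
apply/hZ; split=> [|P SP]; first exact: gY.
apply: contrapT => PV; apply: noP; exists P.
  move=> W /hZ[_ /(_ _ SP) PW] a; have [d homP] := homS _ SP.
  by rewrite (dhomog_meval_scale _ _ homP) PW mulr0.
move=> /(_ V YV 1) P0; apply: PV; rewrite -[RHS]P0.
by apply: meval_eq => i; rewrite mul1r.
Qed.

(** On [Z] the sum reduces to its constant term, which forces [q 0] to be zero; then a factor [h] is
    cancelled on [Y] by primality, and the argument repeats. *)
Lemma cone_vanishes_powers Z Y h K (q : nat -> {mpoly F[D]}) :
  included Z Y -> included Y (grassmannian k U) -> zariski_irreducible k U Y ->
  cone_vanishes Z h -> ~ cone_vanishes Y h ->
  (forall j, cone_vanishes Z (q j) -> q j = 0) ->
  cone_vanishes Y (\sum_(j < K) q j * h ^+ j) ->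
  forall j, (j < K)%N -> q j = 0.
Proof.
move=> ZY gY irrY Zh Yh; elim: K q => [//|K IHK] q hq.
rewrite big_ord_recl expr0 mulr1 /=.
under eq_bigr => i _ do rewrite /bump add1n exprSr mulrA.
rewrite -mulr_suml => hY.
have q0 : q 0 = 0.
  apply: hq; have /(cone_vanishes_included ZY) := hY.
  set r := \sum_(_ < _) _ => hZ; rewrite -[q 0](addrK (r * h)).
  by apply: cone_vanishesD => //; apply/cone_vanishesN/cone_vanishesMl.
move: hY; rewrite q0 add0r => /(cone_vanishes_prime gY irrY)[] // hY [|j] //.
rewrite ltnS; apply: (IHK (fun j => q j.+1)) => // {}j; exact: hq.
Qed.

(** From [C i] to [C i.+1] the family is multiplied by the powers [h ^ j], [j < K], of some [h]
    vanishing on the smaller set only: its size gains a factor [K], while the degrees stay linear in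
    [K]. *)
Lemma chain_growth X p m C : chain_at k U X p m C ->
  forall i, (i <= m)%N -> exists E, forall K,
  exists (T : finType) (b : T -> {mpoly F[D]}),
    [/\ #|T| = (K ^ i)%N, forall t, (msize (b t) <= (E * K).+1)%N &
        forall c : T -> F, cone_vanishes (C i) (\sum_t c t *: b t) ->
          forall t, c t = 0].
Proof.
move=> [hC incC]; elim=> [_|i IHi im].
  exists 0%N => K; exists unit, (fun _ => 1); split=> //.
  - by rewrite card_unit.
  - by move=> _; rewrite msize1.
  move=> c; have [_ [[V CV] _] _ _] := hC 0%N (leq0n m).
  move=> /(_ V CV 1); rewrite raddf_sum (bigD1 tt) //= big1; last by case.
  by rewrite addr0 mevalZ meval1 mulr1 => c0 [].
have [E hE] := IHi (ltnW im); have [clZ irrZ _ _] := hC i (ltnW im).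
have [clY irrY _ _] := hC _ im; have [ZY YZ] := incC _ im.
have gY := zariski_closed_grassmannian clY.
have [h Zh Yh] := cone_vanishes_separates clZ gY YZ.
exists (E + msize h)%N => K; have [T [b [cardT szb freeb]]] := hE K.
exists (T * 'I_K)%type, (fun x : T * 'I_K => b x.1 * h ^+ x.2); split.
- by rewrite card_prod cardT card_ord expnSr.
- move=> [t j] /=; rewrite mulnDl; apply: msize_mul_leq => //.
  apply: leq_trans (msize_exp_leq j (leqnSn _)) _.
  by rewrite ltnS mulnC leq_mul2l ltnW ?orbT.
move=> c hc [t j].
(* [insub] extends the coefficients by 0 beyond [K], as [cone_vanishes_powers] takes a sequence
   indexed by [nat]. *)
pose q (l : nat) := \sum_t (if insub l is Some j then c (t, j) else 0) *: b t.
have qE (j' : 'I_K) : q j' = \sum_t c (t, j') *: b t.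
  by apply: eq_bigr => t' _; rewrite valK.
have hq l : cone_vanishes (C i) (q l) -> q l = 0.
  move=> /freeb cl0; rewrite /q big1 // => t' _.
  by rewrite cl0 scale0r.
have q0 : q j = 0.
  apply: (cone_vanishes_powers ZY gY irrY Zh Yh hq _ (ltn_ord j)).
  suff <- : \sum_x c x *: (b x.1 * h ^+ x.2) = \sum_(j < K) q j * h ^+ j by [].
  under [RHS]eq_bigr => l _ do rewrite qE mulr_suml.
  rewrite exchange_big pair_big /=.
  by apply: eq_bigr => -[t' l] _ /=; rewrite scalerAl.
apply: (freeb (fun t => c (t, j))) => V CV a.
by rewrite -qE q0 meval0.
Qed.

(** A combination that becomes zero after substituting [w] vanishes on the cone over [X], hence over
    its closure and over [C m]. So the family of [chain_growth] stays free in [N] variables, and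
    [card_free_mpoly] bounds its size. *)
Lemma chain_length_bound X p m C N (w : D.-tuple {mpoly F[N]}) :
  included X (grassmannian k U) ->
  (forall V, X V -> forall a, exists y, forall c,
     a * pl V 0 c = (tnth w c).@[y]) ->
  chain_at k U (zariski_closure k U X) p m C -> (m <= N)%N.
Proof.
move=> gX param hC; have [E hE] := chain_growth hC (leqnn m).
pose e := (\max_c msize (tnth w c))%N.
have we c : (msize (tnth w c) <= e.+1)%N by apply/leqW/leq_bigmax.
apply: (@leq_expn_growth (E * e).+1) => K.
have [T [b [<- szb freeb]]] := hE K.
have leT : (#|T| <= (E * K * e).+1 ^ N)%N.
  apply: (@card_free_mpoly _ _ _ _ (fun t => b t \mPo w)) => [t|c c0].
    exact: msize_comp_leq.
  apply: freeb; have [_ _ incC _] := hC.1 m (leqnn m).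
  apply: (cone_vanishes_included incC); apply: cone_vanishes_closure => //.
  move=> V XV a; have [y hy] := param V XV a.
  rewrite (meval_eq _ hy) -comp_mpoly_meval.
  set P := _ \mPo w; have -> : P = 0; last by rewrite meval0.
  rewrite -[RHS]c0 /P raddf_sum /=.
  by apply: eq_bigr => t _; rewrite comp_mpolyZ.
apply: leq_trans leT _.
have [->|N0] := posnP N; first by rewrite !expn0.
by rewrite leq_exp2r // ltnS mulnAC mulSn leq_addl.
Qed.

Lemma local_dimension_leq X p B : included X (grassmannian k U) ->
  zariski_closure k U X p ->
  (forall m C, chain_at k U (zariski_closure k U X) p m C -> (m <= B)%N) ->
  exists2 d, (d <= B)%N & local_dimension k U (zariski_closure k U X) p d.
Proof.
move=> gX Xp hB.
(* Z is the closure of the point p, and gives a chain of length 0. *)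
pose Z V := grassmannian k U V /\
  forall P, homogeneous P -> P.@[pl p 0] = 0 -> P.@[pl V 0] = 0.
have Zincl Y : zariski_closed k U Y -> Y p -> included Z Y.
  move=> [S homS hY] /hY[_ Sp] V [gV hV]; apply/hY; split=> // P SP.
  by apply: hV; [apply: homS|apply: Sp].
have gp : grassmannian k U p.
  apply: (Xp (grassmannian k U)) => //.
  by exists (fun _ => False) => // V; split=> [|[]].
have Zp : Z p by split.
pose has_chain m := `[< exists C, chain_at k U (zariski_closure k U X) p m C >].
have chain0 : exists m, has_chain m.
  exists 0%N; apply/asboolP; exists (fun _ => Z); split=> // i _; split=> //.
  - exists (fun P => homogeneous P /\ P.@[pl p 0] = 0) => [P []//|V].
    by split=> -[gV hV]; split=> // P; [case=> ? ?; apply: hV|move=> hP Pp; apply: hV].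
  - split; first by exists p.
    move=> Y1 Y2 cl1 cl2 /(_ p Zp)[Y1p|Y2p]; [left|right]; exact: Zincl.
  - by move=> V ZV Y clY XY; apply: (Zincl Y) => //; apply: Xp.
have leB m : has_chain m -> (m <= B)%N by move=> /asboolP[C /hB].
have [d /asboolP hd maxd] := ex_maxnP chain0 leB.
exists d; first by case: hd => C /hB.
by split=> // m C hC; apply: maxd; apply/asboolP; exists C.
Qed.

End ZariskiTopology.

(** A subspace of maximal dimension inside [S] is all of [S]: adjoining a vector of [S] stays inside
    [S] and cannot raise the dimension. *)
Lemma vspace_of_Prop (F : fieldType) (vT : vectType F) (S : vT -> Prop) :
  S 0 -> (forall a u v, S u -> S v -> S (a *: u + v)) ->
  exists T : {vspace vT}, forall w, w \in T <-> S w.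
Proof.
move=> S0 SD.
pose has_dim d := `[< exists2 T : {vspace vT},
  (forall w, w \in T -> S w) & \dim T = d >].
have ex_dim : exists d, has_dim d.
  exists 0%N; apply/asboolP; exists 0%VS; last exact: dimv0.
  by move=> w; rewrite memv0 => /eqP ->.
have ubd d : has_dim d -> (d <= \dim {:vT})%N.
  by move=> /asboolP[T _ <-]; apply/dimvS/subvf.
have [d /asboolP[T TS dimT] maxd] := ex_maxnP ex_dim ubd.
exists T => w; split=> [/TS//|Sw].
have TwS x : x \in (<[w]> + T)%VS -> S x.
  by move=> /memv_addP[_ /vlineP[a ->] [v /TS Sv ->]]; apply: SD.
have le_dim : (\dim (<[w]> + T) <= \dim T)%N.
  by rewrite dimT; apply: maxd; apply/asboolP; exists (<[w]> + T)%VS.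
have /eqP -> : T == (<[w]> + T)%VS by rewrite eqEdim addvSr.
exact: (subvP (addvSl _ _)) (memv_line w).
Qed.

Section TangentSpace.

Variables (F : numFieldType) (vT : vectType F) (k : nat) (U : {vspace vT}).
Implicit Types (V : {vspace vT}) (X : {vspace vT} -> Prop).

Local Notation D := (plucker_dim k U).
Local Notation pl := (plucker k U).

Lemma cone_tangent_space_exists X p :
  exists T, cone_tangent_space (k := k) (U := U) X p T.
Proof.
apply: (@vspace_of_Prop _ _ (fun w : 'rV_D =>
  forall P : {mpoly F[D]}, homogeneous P -> vanishes_on X P ->
    \sum_c P^`M(c).@[pl p 0] * w 0 c = 0)).
  by move=> P _ _; rewrite big1 // => c _; rewrite mxE mulr0.
move=> a u v hu hv P homP XP.
under eq_bigr => c _ do rewrite !mxE mulrDr mulrCA.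
by rewrite big_split /= -mulr_sumr hu // hv // mulr0 addr0.
Qed.

Lemma vanishes_on_closure X (P : {mpoly F[D]}) :
  vanishes_on (zariski_closure k U X) P -> vanishes_on X P.
Proof. by move=> hP V XV; apply: hP; apply: included_zariski_closure. Qed.

(** The value t = 0 is left out: there the curve reaches the limit point, whose membership in the
    closure is to be deduced. *)
Definition curve_in_cone X (u : 'I_D -> {poly F}) : Prop :=
  forall P : {mpoly F[D]}, homogeneous P -> vanishes_on X P ->
  forall t, t != 0 -> P.@[fun c => (u c).[t]] = 0.

Lemma curve_in_cone_lim X p u x : grassmannian k U p -> x != 0 ->
  (forall c, (u c).[0] = x * pl p 0 c) -> curve_in_cone X u ->
  zariski_closure k U X p.
Proof.
move=> gp x0 hu hX Z [S homS hZ] XZ; apply/hZ; split=> // P SP.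
have [d homP] := homS _ SP.
have XP : vanishes_on X P by move=> V /XZ/hZ[_ /(_ _ SP)].
have [] := vanish_curve (hX P (homS _ SP) XP); rewrite (meval_eq _ hu).
rewrite (dhomog_meval_scale _ _ homP) => /eqP.
by rewrite mulf_eq0 expf_eq0 (negPf x0) andbF => /eqP.
Qed.

Lemma curve_in_cone_tangent X p u x T : x != 0 ->
  (forall c, (u c).[0] = x * pl p 0 c) -> curve_in_cone X u ->
  cone_tangent_space (zariski_closure k U X) p T ->
  \row_c (u c)^`().[0] \in T.
Proof.
(* The tangent equations are evaluated at the Plücker vector of [p], whereas the curve starts at [x]
   times it; hence the rescaling by [x^-1]. *)
move=> x0 hu hX hT; suff: \row_c (x^-1 * (u c)^`().[0]) \in T.
  move=> /(memvZ x); congr (_ \in T); apply/rowP=> c.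
  by rewrite !mxE mulVKf.
apply/hT => P [d homP] XP.
have := @vanish_curve _ _ (fun c => x^-1 *: u c) P.
case=> [t t0|_].
  under meval_eq => c do rewrite hornerZ.
  rewrite (dhomog_meval_scale _ _ homP) hX ?mulr0 //; first by exists d.
  exact: vanishes_on_closure.
move=> sum0; rewrite -[RHS]sum0; apply: eq_bigr => c _.
rewrite mxE derivZ hornerZ; congr (_ * _).
by apply: meval_eq => i; rewrite hornerZ hu mulKf.
Qed.

End TangentSpace.

(** * Minors *)

(** Multilinearity of the determinant in the rows, row i of the product being a combination of the
    rows of [C] with coefficients [B i j]. *)
Lemma det_mulmx_expand (F : fieldType) k M (B : 'M[F]_(k, M)) (C : 'M_(M, k)) :
  \det (B *m C) =
  \sum_(f : {ffun 'I_k -> 'I_M}) (\prod_i B i (f i)) * \det (rowsub f C).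
Proof.
rewrite [LHS]/determinant.
under eq_bigr => s _ do under eq_bigr => i _ do rewrite mxE.
under eq_bigr => s _ do rewrite bigA_distr_bigA mulr_sumr /=.
rewrite exchange_big; apply: eq_bigr => f _ /=.
rewrite /determinant mulr_sumr; apply: eq_bigr => s _.
rewrite mulrCA -big_split; congr (_ * _).
by apply: eq_bigr => i _; rewrite !mxE.
Qed.

Lemma injective_sort k M (f : 'I_k -> 'I_M) : injective f ->
  exists s : 'S_k, forall i j : 'I_k, (i < j)%N -> (f (s i) < f (s j))%N.
Proof.
move=> injf; pose t := [tuple val (f i) | i < k].
have [s sE] := tuple_permP (t := t) (permEl (perm_sort leq t)).
have : sorted ltn (sort leq t).
  rewrite ltn_sorted_uniq_leq sort_uniq sort_sorted ?andbT; last exact: leq_total.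
  by rewrite map_inj_uniq ?enum_uniq // => i j /val_inj/injf.
rewrite sE => /(sorted_ltn_nth ltn_trans 0%N) h; exists s => i j ij.
have := h i j; rewrite !inE !size_tuple !ltn_ord => /(_ isT isT ij).
by rewrite -(tnth_nth _ _ i) -(tnth_nth _ _ j) !tnth_mktuple.
Qed.

Lemma scalar_fun_sum (F : fieldType) (vT : vectType F) (f : vT -> F) k c
    (e : 'I_k -> vT) :
  (forall a u v, f (a *: u + v) = a * f u + f v) ->
  f (\sum_i c i *: e i) = \sum_i c i * f (e i).
Proof.
move=> lin_f; have f0 : f 0 = 0.
  by have := lin_f (-1) 0 0; rewrite scaler0 addr0 mulN1r addNr.
elim/big_rec2: _ => // i x u _ <-; exact: lin_f.
Qed.

Section PluckerVectors.

Variables (F : fieldType) (vT : vectType F) (k : nat) (U : {vspace vT}).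
Implicit Types (V : {vspace vT}) (b : 'I_k -> vT).

Local Notation D := (plucker_dim k U).

(** Extends the Plücker vector to arbitrary families, even dependent ones, so that it can be
    followed along a curve of families. *)
Definition minors b : 'rV[F]_D :=
  \row_(c < D) \det (\matrix_(i < k, j < k)
    coord (vbasis U) (val (enum_val c : plucker_index k U) j) (b i)).

Lemma plucker_minors V : plucker k U V = minors (fun i => (vbasis V)`_i).
Proof. by []. Qed.

Lemma minors_lincomb (Y : 'M_k) b b' :
  (forall i, b' i = \sum_l Y i l *: b l) -> minors b' = \det Y *: minors b.
Proof.
move=> b'E; apply/rowP=> c; rewrite !mxE -det_mulmx; congr (\det _).
apply/matrixP=> i j; rewrite !mxE b'E linear_sum; apply: eq_bigr => l _ /=.
by rewrite linearZ mxE.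
Qed.

Lemma minors_sub V b : grassmannian k U V -> (forall i, b i \in V) ->
  exists x, minors b = x *: plucker k U V.
Proof.
move=> [_ dimV] bV.
exists (\det (\matrix_(i < k, l < k) coord (vbasis V) (cast_ord (esym dimV) l) (b i))).
rewrite plucker_minors; apply: minors_lincomb => i.
rewrite {1}(coord_vbasis (bV i)) (reindex (cast_ord (esym dimV))) /=; last first.
  by exists (cast_ord dimV) => l _; rewrite ?cast_ordK ?cast_ordKV.
by apply: eq_bigr => l _; rewrite mxE.
Qed.

(** A repeated index gives two equal columns, hence determinant 0; otherwise sorting the columns
    yields a Plücker coordinate up to sign. *)
Lemma minors_any_index (f : 'I_k -> 'I_(\dim U)) :
  exists v : 'cV[F]_D, forall b,
    \det (\matrix_(i, j) coord (vbasis U) (f j) (b i)) = (minors b *m v) 0 0.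
Proof.
have [/injectiveP injf|] := boolP (injectiveb f); last first.
  move=> /injectivePn[i [j ij fij]]; exists 0 => b.
  rewrite mulmx0 mxE -det_tr.
  by apply: (determinant_alternate ij) => l; rewrite !mxE fij.
have [s hs] := injective_sort injf.
have fP : [forall i : 'I_k, forall j : 'I_k, (i < j)%N ==>
    ([ffun i => f (s i)] i < [ffun i => f (s i)] j)%N].
  apply/forallP=> i; apply/forallP=> j; apply/implyP=> ij.
  by rewrite !ffunE hs.
pose g : plucker_index k U := exist (fun f : {ffun 'I_k -> 'I_(\dim U)} =>
  [forall i : 'I_k, forall j : 'I_k, (i < j)%N ==> (f i < f j)%N]) _ fP.
pose c : 'I_D := enum_rank g.
exists ((-1) ^+ s *: delta_mx c 0) => b.
rewrite -scalemxAr mxE -colE mxE mxE enum_rankK /=.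
pose A := \matrix_(i, j) coord (vbasis U) (f j) (b i).
have -> : \matrix_(i < k, j < k)
    coord (vbasis U) ([ffun i => f (s i)] j) (b i) = col_perm s A.
  by apply/matrixP=> i j; rewrite !mxE ffunE.
rewrite col_permE det_mulmx det_perm odd_permV mulrCA -expr2 sqrr_sign mulr1.
by [].
Qed.

(* Cauchy-Binet without the formula: alternating k-linear forms factor linearly
   through the minors. *)
Lemma minors_functional (l : 'I_k -> vT -> F) :
  (forall j a u v, l j (a *: u + v) = a * l j u + l j v) ->
  exists v : 'cV[F]_D, forall b, (forall i, b i \in U) ->
    (minors b *m v) 0 0 = \det (\matrix_(i, j) l j (b i)).
Proof.
move=> lin_l.
have [w hw] := fin_all_exists (fun f : {ffun 'I_k -> 'I_(\dim U)} =>
  minors_any_index f).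
pose L := \matrix_(m < \dim U, j < k) l j (vbasis U)`_m.
exists (\sum_(f : {ffun 'I_k -> 'I_(\dim U)}) (\prod_j L (f j) j) *: w f) => b bU.
pose A := \matrix_(i < k, m < \dim U) coord (vbasis U) m (b i).
have -> : \matrix_(i, j) l j (b i) = A *m L.
  apply/matrixP=> i j; rewrite !mxE {1}(coord_vbasis (bU i)).
  by rewrite (scalar_fun_sum _ _ (lin_l j)); apply: eq_bigr => m _; rewrite !mxE.
rewrite -det_tr trmx_mul det_mulmx_expand mulmx_sumr summxE.
apply: eq_bigr => f _; rewrite -scalemxAr mxE -hw; congr (_ * _).
  by apply: eq_bigr => j _; rewrite !mxE.
by rewrite -det_tr; congr (\det _); apply/matrixP=> i j; rewrite !mxE.
Qed.

End PluckerVectors.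

(** * Cartan subalgebras *)

Lemma dim_lincomb (F : fieldType) (vT : vectType F) k (b : 'I_k -> vT)
    (V : {vspace vT}) :
  (forall i, b i \in V) -> (forall x, x \in V -> exists c, x = \sum_i c i *: b i) ->
  (forall c, \sum_i c i *: b i = 0 -> forall i, c i = 0) -> \dim V = k.
Proof.
move=> bV genV freeb; pose X := [tuple b i | i < k].
have XE (i : 'I_k) : X`_i = b i by rewrite -tnth_nth tnth_mktuple.
have /eqP <- : <<X>>%VS == V.
  rewrite eqEsubv; apply/andP; split.
    by apply/span_subvP=> _ /mapP[i _ ->].
  apply/subvP=> x /genV[c ->]; apply: rpred_sum => i _; apply/rpredZ/memv_span.
  by apply/mapP; exists i; rewrite ?mem_enum.
have /eqP -> : free X; last exact: size_tuple.
apply/freeP=> c; under eq_bigr => i _ do rewrite XE; exact: freeb.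
Qed.

Section CartanSubalgebras.

Variables (F : numFieldType) (m : nat).
Local Notation n := m.+1.
Implicit Types (A : {vspace 'M[F]_n}) (g x : 'M[F]_n).

(** Over [F] these form a basis of the traceless diagonal matrices; the ring varies because they are
    also used with polynomial entries. *)
Definition coroot (R : nzRingType) (i : 'I_m) : 'M[R]_n :=
  delta_mx (lift ord0 i) (lift ord0 i) - delta_mx ord0 ord0.

Lemma diag_coroot_sum (y : 'M[F]_n) : is_diag_mx y -> \tr y = 0 ->
  y = \sum_i y (lift ord0 i) (lift ord0 i) *: coroot F i.
Proof.
move=> /is_diag_mxP diag_y try0; apply/matrixP=> a b; rewrite summxE.
under eq_bigr => i _ do rewrite !mxE.
have [<-{b}|ab] := eqVneq a b; last first.
  have z (l : 'I_n) : (a == l) && (b == l) = false.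
    by apply: contraNF ab => /andP[/eqP -> /eqP ->].
  by rewrite diag_y //; apply/esym/big1 => i _; rewrite !z subrr mulr0.
case: (unliftP ord0 a) => [j|] ->.
  rewrite (bigD1 j) //= big1 ?addr0 => [|i ij].
    by rewrite !eqxx subr0 mulr1.
  by rewrite (inj_eq lift_inj) eq_sym (negPf ij) subrr mulr0.
move/eqP: try0; rewrite /mxtrace big_ord_recl addr_eq0 => /eqP ->.
rewrite -sumrN; apply: eq_bigr => i _.
by rewrite eq_sym -(inj_eq val_inj) /= sub0r mulrN1.
Qed.

Lemma trace_conj g x : g \in unitmx -> \tr (g *m x *m invmx g) = \tr x.
Proof. by move=> gu; rewrite mxtrace_mulC mulmxA mulVmx // mul1mx. Qed.

Lemma trace_conjV g x : g \in unitmx -> \tr (invmx g *m x *m g) = \tr x.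
Proof. by move=> gu; rewrite mxtrace_mulC mulmxA mulmxV // mul1mx. Qed.

Lemma conjmxK g x : g \in unitmx -> invmx g *m (g *m x *m invmx g) *m g = x.
Proof. by move=> gu; rewrite -!mulmxA mulVmx // mulmx1 mulKmx. Qed.

Lemma conjmxVK g x : g \in unitmx -> g *m (invmx g *m x *m g) *m invmx g = x.
Proof. by move=> gu; rewrite -!mulmxA mulmxV // mulmx1 mulKVmx. Qed.

Definition cartan_basis g (i : 'I_m) : 'M[F]_n := g *m coroot F i *m invmx g.

Lemma cartan_space g : g \in unitmx ->
  exists A, cartan A /\
    forall x, x \in A <-> x \in sl F n /\ is_diag_mx (invmx g *m x *m g).
Proof.
move=> gu; have [||A hA] := @vspace_of_Prop _ _ (fun x : 'M[F]_n =>
  x \in sl F n /\ is_diag_mx (invmx g *m x *m g)).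
- by split; [apply: mem0v|rewrite mulmx0 mul0mx mx0_is_diag].
- move=> a u v [su /is_diag_mxP du] [sv /is_diag_mxP dv].
  split; first by rewrite rpredD ?rpredZ.
  apply/is_diag_mxP => i j ij; rewrite mulmxDr mulmxDl -scalemxAr -scalemxAl.
  by rewrite mxE [X in X + _]mxE du // dv // mulr0 addr0.
by exists A; split=> //; exists g.
Qed.

Lemma cartan_basis_sum A g : g \in unitmx ->
  (forall x, x \in A <-> x \in sl F n /\ is_diag_mx (invmx g *m x *m g)) ->
  forall x, x \in A -> x = \sum_i
    (invmx g *m x *m g) (lift ord0 i) (lift ord0 i) *: cartan_basis g i.
Proof.
move=> gu hA x /hA[]; rewrite mem_sl => /eqP trx dx.
rewrite -[LHS](conjmxVK _ gu) {1}(diag_coroot_sum dx) ?trace_conjV //.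
rewrite mulmx_sumr mulmx_suml; apply: eq_bigr => i _.
by rewrite -scalemxAr -scalemxAl.
Qed.

Lemma cartan_grassmannian A : cartan A -> grassmannian m (sl F n) A.
Proof.
move=> [g gu hA]; split; first by apply/subvP=> x /hA[].
apply: (@dim_lincomb _ _ _ (cartan_basis g)).
- move=> i; apply/hA; rewrite mem_sl trace_conj // conjmxK //; split.
    have tr1 (l : 'I_n) : \tr (delta_mx l l : 'M[F]_n) = 1.
      rewrite /mxtrace (bigD1 l) //= big1 => [|j jl]; rewrite mxE ?eqxx ?addr0 //.
      by rewrite (negPf jl).
    by rewrite raddfB /= !tr1 subrr.
  apply/is_diag_mxP=> a b ab.
  have z (l : 'I_n) : (a == l) && (b == l) = false.
    by apply: contraNF ab => /andP[/eqP -> /eqP ->].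
  by rewrite !mxE !z subrr.
- by move=> x /(cartan_basis_sum gu hA) xE; eexists; apply: xE.
- move=> c c0 i.
  have : \sum_i c i *: coroot F i = 0.
    rewrite -[LHS](conjmxK _ gu) mulmx_sumr mulmx_suml.
    under eq_bigr => j _ do rewrite -scalemxAr -scalemxAl.
    by rewrite c0 mulmx0 mul0mx.
  move/matrixP=> /(_ (lift ord0 i) (lift ord0 i)); rewrite summxE mxE.
  rewrite (bigD1 i) //= big1 ?addr0 => [|j ji]; rewrite !mxE /=.
    by rewrite !eqxx subr0 mulr1.
  by rewrite (inj_eq lift_inj) eq_sym (negPf ji) subrr mulr0.
Qed.

(** The family lies in one Cartan subalgebra, so its minors are a multiple, possibly zero, of the
    Plücker vector of that subalgebra. *)
Lemma vanish_minors_diag (P : {mpoly F[plucker_dim m (sl F n)]})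
    (b : 'I_m -> 'M[F]_n) g :
  homogeneous P -> vanishes_on (cartan (F := F) (n := n)) P -> g \in unitmx ->
  (forall i, \tr (b i) = 0 /\ is_diag_mx (invmx g *m b i *m g)) ->
  P.@[minors (sl F n) b 0] = 0.
Proof.
move=> [d homP] XP gu hb; have [A [cA hA]] := cartan_space gu.
have [|x ->] := minors_sub (b := b) (cartan_grassmannian cA).
  by move=> i; apply/hA; rewrite mem_sl; have [-> ->] := hb i.
have -> : P.@[(x *: plucker m (sl F n) A) 0] =
    P.@[fun i => x * plucker m (sl F n) A 0 i].
  by apply: meval_eq => i; rewrite mxE.
by rewrite (dhomog_meval_scale _ _ homP) XP ?mulr0.
Qed.

(** * Polynomial parametrisation of the cone over the Cartan subalgebras *)

Local Notation N := (1 + n * n)%N.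
Local Notation D := (plucker_dim m (sl F n)).

Definition generic_matrix : 'M[{mpoly F[N]}]_n :=
  \matrix_(i, j) 'X_(rshift 1 (mxvec_index i j)).

(** The adjugate stands in for the inverse to keep the entries polynomial; on an invertible matrix
    this only introduces a determinant factor. *)
Definition generic_basis i : 'M[{mpoly F[N]}]_n :=
  generic_matrix *m coroot _ i *m \adj generic_matrix.

Definition generic_minor (c : 'I_D) : {mpoly F[N]} :=
  'X_(lshift (n * n) 0) * \det (\matrix_(i < m, j < m) \sum_p \sum_q
    coord (vbasis (sl F n)) (val (enum_val c : plucker_index m (sl F n)) j)
      (delta_mx p q) *: generic_basis i p q).

Lemma generic_minor_eval (y : 'I_N -> F) c (g : 'M[F]_n) :
  (forall i j, y (rshift 1 (mxvec_index i j)) = g i j) ->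
  (generic_minor c).@[y] = y (lshift (n * n) 0) *
    minors (sl F n) (fun i => g *m coroot F i *m \adj g) 0 c.
Proof.
move=> yg; rewrite mevalM mevalXU mxE; congr (_ * _).
have gE : map_mx (meval y) generic_matrix = g.
  by apply/matrixP=> i j; rewrite !mxE mevalXU.
rewrite -det_map_mx; congr (\det _); apply/matrixP=> i j; rewrite !mxE.
have <- : map_mx (meval y) (generic_basis i) = g *m coroot F i *m \adj g.
  rewrite !map_mxM map_mx_adj gE; congr (_ *m _ *m _).
  by rewrite map_mxB !map_delta_mx.
rewrite [X in coord _ _ X]matrix_sum_delta linear_sum raddf_sum.
apply: eq_bigr => p _; rewrite linear_sum raddf_sum; apply: eq_bigr => q _.
by rewrite linearZ /= mevalZ mulrC [in RHS]mxE.
Qed.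

Lemma cartan_parametrization (A : {vspace 'M[F]_n}) : cartan A ->
  forall a, exists y, forall c, a * plucker m (sl F n) A 0 c =
    (tnth [tuple generic_minor c | c < D] c).@[y].
Proof.
move=> cA a; have [_ dimA] := cartan_grassmannian cA; have [g gu hA] := cA.
have detg : \det g != 0 by rewrite -unitfE -unitmxE.
(* [Y] expresses the basis of [A] in the matrices [g *m coroot F l *m \adj g], the factor
   [(\det g)^-1] undoing the adjugate. The scale variable then absorbs [a * \det Y]. *)
pose Y := \matrix_(i < m, l < m) ((\det g)^-1 *
  (invmx g *m (vbasis A)`_i *m g) (lift ord0 l) (lift ord0 l)).
pose y := row_mx (const_mx (a * \det Y)) (mxvec g) 0 : 'I_N -> F.
exists y => c; rewrite tnth_mktuple (@generic_minor_eval y c g); last first.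
  by move=> i j; rewrite /y row_mxEr mxvecE.
rewrite /y row_mxEl [const_mx _ _ _]mxE plucker_minors -mulrA; congr (_ * _).
rewrite (@minors_lincomb _ _ _ _ Y (fun i => g *m coroot F i *m \adj g)).
  by rewrite mxE.
move=> i; rewrite {1}(cartan_basis_sum gu hA (x := (vbasis A)`_i)); last first.
  by apply/vbasis_mem/mem_nth; rewrite size_tuple dimA.
apply: eq_bigr => l _; have -> : cartan_basis g l =
    (\det g)^-1 *: (g *m coroot F l *m \adj g).
  by rewrite /cartan_basis /invmx gu -scalemxAr.
by rewrite scalerA mulrC [Y i l]mxE.
Qed.

Lemma Red_chain_bound (p : {vspace 'M[F]_n}) l C :
  chain_at m (sl F n) (@Red F n) p l C -> (l <= N)%N.
Proof.
apply: chain_length_bound (@cartan_grassmannian) _ => V cV.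
exact: cartan_parametrization.
Qed.

End CartanSubalgebras.

(** * Tangent directions *)

Section MinorCurves.

Variables (F : numFieldType) (vT : vectType F) (k : nat) (U : {vspace vT}).
Local Notation D := (plucker_dim k U).

Definition minor_curve (b b1 : 'I_k -> vT) (c : 'I_D) : {poly F} :=
  let f := val (enum_val c : plucker_index k U) in
  \det (\matrix_(i < k, j < k)
    ((coord (vbasis U) (f j) (b i))%:P + 'X * (coord (vbasis U) (f j) (b1 i))%:P)).

Lemma horner_det k' (M : 'M[{poly F}]_k') t :
  (\det M).[t] = \det (map_mx (horner_eval t) M).
Proof. by rewrite det_map_mx. Qed.

Lemma minor_curveE b b1 c t :
  (minor_curve b b1 c).[t] = minors U (fun i => b i + t *: b1 i) 0 c.
Proof.
rewrite horner_det mxE; congr (\det _); apply/matrixP=> i j; rewrite !mxE.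
by rewrite horner_evalE hornerD hornerM hornerX !hornerC linearD linearZ.
Qed.

Lemma minor_curve_functional (l : 'I_k -> vT -> F) (v : 'cV[F]_D) b b1 :
  (forall j a u v, l j (a *: u + v) = a * l j u + l j v) ->
  (forall b, (forall i, b i \in U) ->
    (minors U b *m v) 0 0 = \det (\matrix_(i, j) l j (b i))) ->
  (forall i, b i \in U) -> (forall i, b1 i \in U) ->
  \sum_c minor_curve b b1 c * (v c 0)%:P =
  \det (\matrix_(i < k, j < k) ((l j (b i))%:P + 'X * (l j (b1 i))%:P)).
Proof.
move=> lin_l hv bU b1U; apply/eqP; rewrite -subr_eq0; apply/eqP.
apply: poly_eq0_horner => t _; apply/eqP.
rewrite hornerD hornerN subr_eq0 horner_det horner_sum; apply/eqP.
transitivity ((minors U (fun i => b i + t *: b1 i) *m v) 0 0).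
  by rewrite [RHS]mxE; apply: eq_bigr => c _; rewrite hornerM hornerC minor_curveE.
rewrite hv => [|i]; last by rewrite rpredD ?rpredZ.
congr (\det _); apply/matrixP=> i j; rewrite !mxE.
rewrite horner_evalE hornerD hornerM hornerX !hornerC addrC lin_l.
by rewrite addrC.
Qed.

End MinorCurves.

(** In the expansion along column [r] the cofactors do not see that column, so they are those of the
    identity matrix. *)
Lemma det_replace_col (R : comNzRingType) k r (h : 'I_k -> R) :
  \det (\matrix_(i, j) if j == r then h i else (i == j)%:R) = h r.
Proof.
set M := \matrix_(i, j) _.
have cofM i : cofactor M i r = (\adj (1%:M : 'M[R]_k)) r i.
  rewrite [RHS]mxE; congr (_ * \det _); apply/matrixP=> a b; rewrite !mxE.
  by rewrite eq_sym (negPf (neq_lift _ _)).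
have adj1 : \adj (1%:M : 'M[R]_k) = 1%:M.
  by rewrite -[LHS]mul1mx mul_mx_adj det1.
rewrite (expand_det_col _ r) (bigD1 r) //= big1 ?addr0 => [|i ir].
  by rewrite cofM adj1 !mxE !eqxx mulr1.
by rewrite cofM adj1 [_ r i]mxE eq_sym (negPf ir) mulr0.
Qed.

(** * Split multiplications and their diagonalisable deformations *)

Section SplitAlgebras.

Variables (F : numFieldType) (m : nat).
Local Notation n := m.+1.

Definition nil_basis (i : 'I_m) : 'M[F]_n :=
  block_mx (0 : 'M_1) (delta_mx 0 i) 0 0.

(* The operator of multiplication by the i-th basis row vector, for the
   multiplication in which the rows f_j of Q satisfy f_j f_l = delta_jl tau_j f_j. *)
Definition mult_mx (Q : 'M[F]_m) (tau : 'I_m -> F) (i : 'I_m) : 'M[F]_m :=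
  invmx Q *m diag_mx (\row_j (tau j * invmx Q i j)) *m Q.

Definition direction Q tau i : 'M[F]_n :=
  let a := - \tr (mult_mx Q tau i) / n%:R in
  block_mx (a%:M : 'M_1) 0 0 (a%:M + mult_mx Q tau i).

Lemma trace_nil_basis i : \tr (nil_basis i) = 0.
Proof. by rewrite (mxtrace_block (n1 := 1)) !mxtrace0 addr0. Qed.

Lemma trace_direction Q tau i : \tr (direction Q tau i) = 0.
Proof.
rewrite (mxtrace_block (n1 := 1)) raddfD /= !mxtrace_scalar addrA -mulrnDr add1n.
by rewrite -[_ *+ n]mulr_natr mulfVK ?addNr // pnatr_eq0.
Qed.

Lemma direction_diag Q tau t : Q \in unitmx -> (forall j, tau j != 0) -> t != 0 ->
  exists2 g : 'M[F]_n, g \in unitmx & forall i,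
    is_diag_mx (invmx g *m (nil_basis i + t *: direction Q tau i) *m g).
Proof.
move=> Qu tau0 t0.
(* Conjugating by diag(1, Q) makes the lower right block diagonal; the row s
   then clears the upper right one. *)
pose s : 'rV[F]_m := \row_j - (t * tau j)^-1.
pose H : 'M[F]_(1 + m) := block_mx 1%:M (s *m Q) 0 Q.
pose K : 'M[F]_(1 + m) := block_mx 1%:M (- s) 0 (invmx Q).
have HK : H *m K = 1%:M.
  rewrite mulmx_block !mul1mx !mul0mx !mulmx0 !addr0 !add0r mulmxK // addNr.
  by rewrite mulmxV // -scalar_mx_block.
have [Hu Ku] := mulmx1_unit HK.
have KH : invmx K = H by rewrite -[LHS]mul1mx -HK mulmxK.
exists K => // i; rewrite KH.
pose a := - \tr (mult_mx Q tau i) / n%:R.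
have -> : nil_basis i + t *: direction Q tau i =
    (t * a)%:M + block_mx (0 : 'M_1) (delta_mx 0 i) 0 (t *: mult_mx Q tau i).
  rewrite /nil_basis /direction -/a (@scale_block_mx _ 1 m 1 m) !scaler0.
  rewrite [(_ * a)%:M](scalar_mx_block 1 m) !(@add_block_mx _ 1 m 1 m) !add0r !addr0.
  by rewrite scalerDr !scale_scalar_mx.
rewrite mulmxDr mulmxDl mul_mx_scalar -scalemxAl HK.
set Del := diag_mx (\row_j (tau j * invmx Q i j)).
have -> : H *m block_mx (0 : 'M_1) (delta_mx 0 i) 0 (t *: mult_mx Q tau i) *m K =
    block_mx (0 : 'M_1) 0 0 (t *: Del).
  rewrite !mulmx_block !mul1mx !mul0mx !mulmx0 !addr0 !add0r.
  rewrite -!scalemxAr -!scalemxAl /mult_mx -/Del !mulmxA (mulmxK Qu) mulmxV // mul1mx.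
  rewrite mulmxDl -!scalemxAl -!mulmxA mulmxV // !mulmx1.
  rewrite !mul0mx !add0r -rowE mul_mx_diag; congr block_mx.
  (* Entry j of the upper right block is [invmx Q i j] times 1 + t tau_j s_j, which is zero for the
     chosen [s]. *)
  apply/rowP=> j; rewrite !mxE.
  by field; rewrite t0 tau0.
rewrite scale_scalar_mx mulr1 (scalar_mx_block 1 m) (@add_block_mx _ 1 m 1 m).
rewrite !addr0 (@is_diag_block_mx _ 1 m 1 m) // !eqxx /=.
apply/andP; split; apply/is_diag_mxP => x y xy; rewrite !mxE.
  by case/eqP: xy; rewrite !ord1.
by rewrite -val_eqE (negPf xy) !mulr0n mulr0 addr0.
Qed.

End SplitAlgebras.

Lemma memv_eq (K : fieldType) (vT : vectType K) (W : {vspace vT}) u v :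
  u \in W -> v = u -> v \in W.
Proof. by move=> Wu ->. Qed.

(** * Lower bound for the dimension of the tangent space *)

Section TangentDimension.

Variables (F : numFieldType) (m : nat).
Local Notation n := m.+1.
Local Notation D := (plucker_dim m (sl F n)).

Lemma ord0_lshift : (ord0 : 'I_n) = lshift m (ord0 : 'I_1).
Proof. exact: val_inj. Qed.

Definition ordered_pair : finType := {x : 'I_m * 'I_m | (x.1 <= x.2)%N}.
(** [None] stands for the direction of the Plücker vector itself; the other indices label a basis of
    the symmetric square of the dual of C^m, tensored with C^m. *)
Definition tangent_index : finType := option (ordered_pair * 'I_m).
Local Notation J := tangent_index.

(** The half square [A] and its mirror image [B] cover the square and share the diagonal, so their
    sizes add up to at least m^2 + m. *)
Lemma card_ordered_pair : (m * m + m <= 2 * #|{: ordered_pair}|)%N.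
Proof.
pose A := [pred x : 'I_m * 'I_m | (x.1 <= x.2)%N].
pose B := [pred x : 'I_m * 'I_m | (x.2 <= x.1)%N].
have -> : #|{: ordered_pair}| = #|A| by rewrite card_sig.
have AB : #|B| = #|A|.
  rewrite -(card_image (f := fun x : 'I_m * 'I_m => (x.2, x.1)) _ A).
    apply: eq_card => -[x y]; rewrite !inE /=; apply/idP/imageP => [yx|].
      by exists (y, x).
    by case=> -[a b] /=; rewrite inE /= => ab [-> ->].
  by move=> [a b] [c d] [-> ->].
rewrite mul2n -addnn -{2}AB -cardUI leq_add //.
  rewrite -[in X in (X * X)%N](card_ord m) -card_prod; apply: subset_leq_card.
  by apply/subsetP=> x _; rewrite !inE leq_total.
rewrite -[X in (X <= _)%N](card_ord m).
rewrite -(card_image (f := fun x : 'I_m => (x, x)) _ predT); last by move=> a b [].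
apply: subset_leq_card; apply/subsetP=> _ /imageP[x _ ->].
by rewrite !inE leqnn.
Qed.

Lemma card_tangent_index : #|{: J}| = (#|{: ordered_pair}| * m).+1.
Proof. by rewrite card_option card_prod card_ord. Qed.

(** [theta] will be a conjugation for [Omin'], and transposition followed by a conjugation for
    [Omin''], so that one computation serves both orbits. *)
Variables (theta theta' : {linear 'M[F]_n -> 'M[F]_n}).
Hypothesis thetaK : cancel theta theta'.
Hypothesis theta_tr : forall y, \tr (theta y) = \tr y.
Hypothesis theta_diag : forall g, g \in unitmx ->
  exists2 g', g' \in unitmx & forall y,
    is_diag_mx (invmx g *m y *m g) -> is_diag_mx (invmx g' *m theta y *m g').

(* On theta(M_n): the i-th form is the coordinate (0, i+1), except that for
   j = Some (r, b) the one of index r.1 reads the entry (r.2, b) of D_i, the scalar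
   a_i being removed by subtracting the coordinate (0, 0). *)
Definition entry_form (j : J) (i : 'I_m) (x : 'M[F]_n) : F :=
  let y := theta' x in
  if j is Some (r, b) then
    if i == (val r).1 then
      y (lift ord0 (val r).2) (lift ord0 b) - ((val r).2 == b)%:R * y ord0 ord0
    else y ord0 (lift ord0 i)
  else y ord0 (lift ord0 i).

Lemma entry_form_linear j i a u v :
  entry_form j i (a *: u + v) = a * entry_form j i u + entry_form j i v.
Proof.
rewrite /entry_form linearP; case: j => [[r b]|]; last by rewrite !mxE.
by case: eqP => _; rewrite !mxE //; ring.
Qed.

Lemma entry_form_nil j i l : entry_form j i (theta (nil_basis F l)) =
  if j is Some (r, b) then (i != (val r).1)%:R * (l == i)%:R else (l == i)%:R.
Proof.
rewrite /entry_form thetaK /nil_basis; case: j => [[r b]|].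
  rewrite -!rshift1 !ord0_lshift (@block_mxEur _ 1 m 1 m) (@block_mxEul _ 1 m 1 m).
  rewrite (@block_mxEdr _ 1 m 1 m) !mxE eqxx /= [i == l]eq_sym.
  by case: eqP; rewrite ?mul0r ?mul1r ?mulr0 ?subrr.
by rewrite -!rshift1 !ord0_lshift (@block_mxEur _ 1 m 1 m) !mxE eqxx eq_sym.
Qed.

Lemma entry_form_direction Q tau j i l : entry_form j i (theta (direction Q tau l)) =
  if j is Some (r, b) then (i == (val r).1)%:R * mult_mx Q tau l (val r).2 b else 0.
Proof.
rewrite /entry_form thetaK /direction; set a := - \tr _ / _.
move: a (mult_mx Q tau l) => a A; case: j => [[r b]|].
  rewrite -!rshift1 !ord0_lshift (@block_mxEur _ 1 m 1 m) (@block_mxEul _ 1 m 1 m).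
  rewrite (@block_mxEdr _ 1 m 1 m) !mxE eqxx /= [i == _]eq_sym.
  case: eqP => _; rewrite ?mul0r ?mul1r // mulr1n mulr_natl.
  by rewrite addrAC subrr add0r.
by rewrite -!rshift1 !ord0_lshift (@block_mxEur _ 1 m 1 m) mxE.
Qed.

(** The tensor x (x) x (x) f in the coordinates [J], with zero [None] coordinate. *)
Definition cubic (x f : 'I_m -> F) : 'rV[F]_#|{: J}| :=
  \row_j (if enum_val j is Some (r, b) then x (val r).1 * x (val r).2 * f b else 0).

Section Tangent.

Variable p : {vspace 'M[F]_n}.
Hypothesis gp : grassmannian m (sl F n) p.
Hypothesis nil_p : forall i, theta (nil_basis F i) \in p.

Local Notation curve Q tau := (@minor_curve F _ m (sl F n)
  (fun i => theta (nil_basis F i)) (fun i => theta (direction Q tau i))).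

Lemma curve_in_cartan_cone Q tau : Q \in unitmx -> (forall j, tau j != 0) ->
  curve_in_cone (cartan (F := F) (n := n)) (curve Q tau).
Proof.
move=> Qu tau0 P homP XP t t0.
have [g gu hg] := direction_diag Qu tau0 t0; have [g' g'u hg'] := theta_diag gu.
rewrite (meval_eq _ (fun c => minor_curveE _ _ c t)).
apply: (vanish_minors_diag homP XP g'u) => i; rewrite -linearZ -linearD.
split; last exact/hg'/hg.
rewrite theta_tr raddfD /= trace_nil_basis.
by rewrite mxtraceZ trace_direction mulr0 addr0.
Qed.

Lemma curve0 Q tau : exists x, forall c, (curve Q tau c).[0] =
  x * plucker m (sl F n) p 0 c.
Proof.
have [x hx] := minors_sub gp nil_p; exists x => c.
have := congr1 (fun v : 'rV_D => v 0 c) hx; rewrite [in RHS]mxE => <-.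
rewrite minor_curveE mxE [RHS]mxE; congr (\det _).
by apply/matrixP=> i j; rewrite !mxE scale0r addr0.
Qed.

(** Along the curve the forms of index [None] have the identity as their matrix; for [Some (r, b)]
    its column [(val r).1] is replaced by t times the entries of position ((r).2, b) of the
    operators, so the determinant reads off a single entry. *)
Lemma entry_functional : exists M : 'M[F]_(D, #|{: J}|),
  forall Q tau j, \sum_c curve Q tau c * (M c j)%:P =
    if enum_val j is Some (r, b)
    then 'X * (mult_mx Q tau (val r).1 (val r).2 b)%:P else 1.
Proof.
have /fin_all_exists[v hv] j :=
  minors_functional (sl F n) (entry_form_linear j).
exists (\matrix_(c, j) v (enum_val j) c 0) => Q tau j.
under eq_bigr => c _ do rewrite mxE.
rewrite (minor_curve_functional (entry_form_linear _) (hv _)); last 2 first.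
- by move=> i; rewrite mem_sl theta_tr trace_nil_basis.
- by move=> i; rewrite mem_sl theta_tr trace_direction.
under eq_mx => i l do rewrite entry_form_nil entry_form_direction.
case: (enum_val j) => [[r b]|]; last first.
  rewrite -[RHS](det1 _ m); congr (\det _); apply/matrixP=> i l.
  by rewrite !mxE mulr0 addr0 polyC_natr.
rewrite -(det_replace_col (val r).1 (fun i => 'X * (mult_mx Q tau i (val r).2 b)%:P)).
congr (\det _); apply/matrixP=> i l; rewrite !mxE.
case: eqP => _; rewrite ?mul0r ?mul1r ?add0r //.
by rewrite mulr0 addr0 polyC_natr.
Qed.

(** The functional of index [None] is 1 along the curve, so the starting vector is not zero. *)
Lemma curve0_neq0 Q tau : exists2 x, x != 0 & forall c, (curve Q tau c).[0] =
  x * plucker m (sl F n) p 0 c.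
Proof.
have [x hx] := curve0 Q tau; exists x => //; apply/eqP => x0.
have [M hM] := entry_functional.
have := congr1 (fun q => q.[0]) (hM Q tau (enum_rank None)).
rewrite enum_rankK hornerE horner_sum big1 => [/eqP|c _].
  by rewrite eq_sym oner_eq0.
by rewrite hornerM hx x0 !mul0r.
Qed.

Lemma nil_in_Red : Red p.
Proof.
have [x x0 hx] := curve0_neq0 1%:M (fun _ => 1).
apply: (curve_in_cone_lim gp x0 hx); apply: curve_in_cartan_cone.
  exact: unitmx1.
by move=> j; apply: oner_neq0.
Qed.

Variable T : {vspace 'rV[F]_D}.
Hypothesis tanT : cone_tangent_space (@Red F n) p T.

Section Image.

Variable M : 'M[F]_(D, #|{: J}|).
Hypothesis hM : forall Q tau j, \sum_c curve Q tau c * (M c j)%:P =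
    if enum_val j is Some (r, b)
    then 'X * (mult_mx Q tau (val r).1 (val r).2 b)%:P else 1.

(** Once this image is shown to be the full space, [\dim T] is at least the number of indices in
    [J]. *)
Definition tangent_image : {vspace 'rV[F]_#|{: J}|} := (linfun (mulmxr M) @: T)%VS.

Lemma mem_tangent_image (u : 'I_D -> {poly F}) :
  \row_c (u c)^`().[0] \in T ->
  \row_j (\sum_c u c * (M c j)%:P)^`().[0] \in tangent_image.
Proof.
move=> /(memv_img (linfun (mulmxr M))); rewrite lfunE /= => /memv_eq; apply.
apply/rowP=> j; rewrite !mxE raddf_sum horner_sum; apply: eq_bigr => c _ /=.
by rewrite derivM derivC mulr0 addr0 hornerM hornerC mxE.
Qed.

Lemma tensor_in_image Q tau : Q \in unitmx -> (forall j, tau j != 0) ->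
  \row_j (if enum_val j is Some (r, b)
          then mult_mx Q tau (val r).1 (val r).2 b else 0) \in tangent_image.
Proof.
move=> Qu tau0; have [x x0 hx] := curve0_neq0 Q tau.
have := mem_tangent_image
  (curve_in_cone_tangent x0 hx (curve_in_cartan_cone Qu tau0) tanT).
move/memv_eq; apply; apply/rowP=> j; rewrite !mxE hM.
case: (enum_val j) => [[r b]|]; last by rewrite derivC horner0.
by rewrite derivM derivX derivC mulr0 addr0 mul1r hornerC.
Qed.

Lemma None_in_image : delta_mx 0 (enum_rank None) \in tangent_image.
Proof.
pose tau := fun _ : 'I_m => 1 : F; have tau0 j : tau j != 0 by exact: oner_neq0.
have Qu := unitmx1 F m; have [x x0 hx] := curve0_neq0 1%:M tau.
(* Rescaling the curve by 1 + t adds its base point to its tangent vector. *)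
pose u c := (1 + 'X) * curve 1%:M tau c.
have hu c : (u c).[0] = x * plucker m (sl F n) p 0 c.
  by rewrite hornerM hornerD hornerX hornerC addr0 mul1r hx.
have cu : curve_in_cone (cartan (F := F) (n := n)) u.
  move=> P [d homP] XP t t0.
  under meval_eq => c do rewrite hornerM.
  rewrite (dhomog_meval_scale _ _ homP) curve_in_cartan_cone ?mulr0 //.
  by exists d.
have hI := mem_tangent_image (curve_in_cone_tangent x0 hu cu tanT).
rewrite -[X in X \in _](addrK (\row_j (if enum_val j is Some (r, b)
          then mult_mx 1%:M tau (val r).1 (val r).2 b else 0))).
rewrite rpredB ?tensor_in_image //.
apply: (memv_eq hI); apply/rowP=> j; rewrite !mxE.
under eq_bigr => c _ do rewrite -mulrA.
rewrite -mulr_sumr hM derivM derivD derivX derivC add0r mul1r hornerD hornerM.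
rewrite hornerD hornerX hornerC addr0 mul1r /=.
rewrite -(inj_eq enum_val_inj) enum_rankK.
case: (enum_val j) => [[r b]|] /=; rewrite ?derivM ?derivX ?derivC ?hornerE /=.
  by rewrite ?mul0r ?mulr0 ?add0r ?addr0 ?mul1r.
by [].
Qed.

Lemma cubic_in_image Q i : Q \in unitmx ->
  cubic (fun a => invmx Q a i) (fun b => Q i b) \in tangent_image.
Proof.
(* The tensor of a split multiplication is linear in tau; comparing
   tau = 1 + delta_i with tau = 1 isolates the i-th idempotent. *)
move=> Qu; pose tau2 := fun j : 'I_m => 1 + (j == i)%:R : F.
have tau20 j : tau2 j != 0.
  rewrite /tau2; case: (j == i); last by rewrite addr0 oner_eq0.
  by rewrite -[1 + _]/(2%:R) pnatr_eq0.
have := rpredB (tensor_in_image Qu tau20)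
  (tensor_in_image Qu (fun j : 'I_m => oner_neq0 F)).
move/memv_eq; apply; apply/rowP=> j; rewrite !mxE.
case: (enum_val j) => [[r b]|]; last by rewrite subr0.
rewrite /mult_mx !mul_mx_diag !mxE -sumrB (bigD1 i) //= big1 ?addr0 => [|l li].
  by rewrite !mxE /tau2 eqxx /=; ring.
by rewrite !mxE /tau2 (negPf li) /=; ring.
Qed.

(** Row r of an invertible matrix and column r of its inverse pair to 1. The hypotheses make e_r + h
    and e_r + y such a pair, and two elementary factors realise it. *)
Lemma cubic_perturb_in_image r (y h : 'I_m -> F) :
  y r = 0 -> h r = 0 -> \sum_a h a * y a = 0 ->
  cubic (fun a => (a == r)%:R + y a) (fun b => (b == r)%:R + h b) \in tangent_image.
Proof.
move=> yr hr hy0; pose e : 'cV[F]_m := delta_mx r 0.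
pose Y := \col_a y a; pose H := \row_b h b.
have eY : e^T *m Y = 0.
  by apply/matrixP=> i j; rewrite trmx_delta -rowE !mxE.
have He : H *m e = 0.
  by apply/matrixP=> i j; rewrite -colE !mxE.
have HY : H *m Y = 0.
  apply/matrixP=> i j; rewrite !mxE -[RHS]hy0.
  by apply: eq_bigr => a _; rewrite !mxE.
have ee : e^T *m e = 1%:M.
  by apply/matrixP=> i j; rewrite trmx_delta -rowE !mxE !ord1 !eqxx.
(* Row r of Q is e_r + h and column r of its inverse is e_r + y. *)
pose Q := (1%:M - Y *m e^T) *m (1%:M + e *m H).
pose Q' := (1%:M - e *m H) *m (1%:M + Y *m e^T).
have QQ' : Q *m Q' = 1%:M.
  have eHeH : e *m H *m (e *m H) = 0 by rewrite mulmxA -(mulmxA e) He mulmx0 mul0mx.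
  have YeYe : Y *m e^T *m (Y *m e^T) = 0.
    by rewrite mulmxA -(mulmxA Y) eY mulmx0 mul0mx.
  have BB' : (1%:M + e *m H) *m (1%:M - e *m H) = 1%:M.
    rewrite mulmxDl !mulmxBr !mul1mx !mulmx1 eHeH subr0.
    by rewrite subrK.
  rewrite /Q /Q' -mulmxA (mulmxA (1%:M + e *m H)) BB' mul1mx.
  rewrite mulmxBl !mulmxDr !mul1mx !mulmx1 YeYe addr0.
  by rewrite addrK.
have [Qu _] := mulmx1_unit QQ'.
have invQ : invmx Q = Q' by rewrite -[LHS]mulmx1 -QQ' mulKmx.
apply: (memv_eq (cubic_in_image r Qu)); apply/rowP=> j; rewrite !mxE.
have Q'e a : invmx Q a r = (a == r)%:R + y a.
  have -> : invmx Q a r = (Q' *m e) a 0 by rewrite invQ -colE [RHS]mxE.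
  have A'e : (1%:M + Y *m e^T) *m e = e + Y.
    by rewrite mulmxDl mul1mx -mulmxA ee mulmx1.
  rewrite /Q' -mulmxA A'e mulmxBl mul1mx -mulmxA.
  by rewrite mulmxDr He HY addr0 mulmx0 subr0 !mxE andbT.
have eQ b : Q r b = (b == r)%:R + h b.
  have -> : Q r b = (e^T *m Q) 0 b by rewrite trmx_delta -rowE [RHS]mxE.
  have eA : e^T *m (1%:M - Y *m e^T) = e^T.
    by rewrite mulmxBr mulmx1 mulmxA eY mul0mx subr0.
  by rewrite /Q mulmxA eA mulmxDr mulmx1 mulmxA ee mul1mx !mxE andbT.
by case: (enum_val j) => [[s b]|] //; rewrite !Q'e eQ.
Qed.

Definition monomial (a1 a2 b : 'I_m) : 'rV[F]_#|{: J}| :=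
  \row_j (if enum_val j is Some (r, b')
    then ((val r).1 == a1)%:R * ((val r).2 == a2)%:R * (b' == b)%:R else 0).

(** Write e for the two symmetric factors and f for the last one. Both e_a^2 f_a and e_a^2 (f_a +
    f_b) are attained; subtract. *)
Lemma monomial_square_in_image a b : monomial a a b \in tangent_image.
Proof.
have cub h : h a = 0 -> cubic (fun x => (x == a)%:R) (fun b => (b == a)%:R + h b)
    \in tangent_image.
  move=> ha; have h0 : \sum_x h x * (0 : F) = 0 by rewrite big1 // => x _; rewrite mulr0.
  apply: (memv_eq (cubic_perturb_in_image (erefl 0) ha h0)).
  by apply/rowP=> j; rewrite !mxE; case: (enum_val j) => [[r c]|] //; rewrite !addr0.
have aaa : monomial a a a \in tangent_image.
  apply: (memv_eq (cub _ (erefl 0))); apply/rowP=> j; rewrite !mxE.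
  by case: (enum_val j) => [[r c]|] //; rewrite addr0.
have [<-//|ab] := eqVneq a b.
apply: (memv_eq (rpredB (cub (fun x => (x == b)%:R) _) aaa)).
  by rewrite (negPf ab).
apply/rowP=> j; rewrite !mxE; case: (enum_val j) => [[r c]|]; last by rewrite subr0.
by ring.
Qed.

Lemma monomial_sym_in_image a1 a2 b : a1 != a2 ->
  monomial a1 a2 b + monomial a2 a1 b \in tangent_image.
Proof.
pose sym x y c := monomial x y c + monomial y x c.
have symxyx x y : x != y -> sym x y x \in tangent_image.
  move=> xy; have h0 : \sum_z (0 : F) * (z == y)%:R = 0.
    by rewrite big1 // => z _; rewrite mul0r.
  have y0 : (x == y)%:R = 0 :> F by rewrite (negPf xy).
  (* Removing e_x^2 f_x and e_y^2 f_x from (e_x + e_y)^2 f_x leaves the mixed term. *)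
  have := cubic_perturb_in_image y0 (erefl 0) h0.
  move=> /rpredB/(_ (monomial_square_in_image x x)).
  move=> /rpredB/(_ (monomial_square_in_image y x)).
  move/memv_eq; apply; apply/rowP=> j; rewrite !mxE.
  by case: (enum_val j) => [[r c]|]; [ring|rewrite !subr0 addr0].
move=> a12; have [->|b1] := eqVneq b a1; first exact: symxyx.
have [->|b2] := eqVneq b a2; first by rewrite addrC; apply: symxyx; rewrite eq_sym.
have h0 : \sum_z (z == b)%:R * (z == a2)%:R = 0 :> F.
  rewrite big1 // => z _; case: (eqVneq z b) => [->|_]; last exact: mul0r.
  by rewrite (negPf b2) mulr0.
have y0 : (a1 == a2)%:R = 0 :> F by rewrite (negPf a12).
have hb0 : (a1 == b)%:R = 0 :> F by rewrite eq_sym (negPf b1).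
(* The cubic is (e_a1 + e_a2)^2 (f_a1 + f_b); removing the four square terms and the mixed term in
   f_a1 leaves the mixed term in f_b. *)
have := cubic_perturb_in_image y0 hb0 h0.
move=> /rpredB/(_ (monomial_square_in_image a1 a1)).
move=> /rpredB/(_ (monomial_square_in_image a1 b)).
move=> /rpredB/(_ (monomial_square_in_image a2 a1)).
move=> /rpredB/(_ (monomial_square_in_image a2 b)).
move=> /rpredB/(_ (symxyx _ _ a12)).
move/memv_eq; apply; apply/rowP=> j; rewrite !mxE.
by case: (enum_val j) => [[r c]|]; [ring|rewrite !(subr0, addr0)].
Qed.

Lemma tangent_image_full : tangent_image = fullv.
Proof.
apply/eqP; rewrite eqEsubv subvf; apply/subvP=> w _.
rewrite [w]row_sum_delta; apply: rpred_sum => j _; apply: rpredZ.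
case Ej: (enum_val j) => [[r b]|]; last first.
  by rewrite -(enum_valK j) Ej; apply: None_in_image.
have deltaE a1 a2 : (val r).1 = a1 -> (val r).2 = a2 ->
    delta_mx 0 j = monomial a1 a2 b.
  move=> <- <-; apply/rowP=> l; rewrite !mxE eqxx -(inj_eq enum_val_inj) Ej /=.
  case: (enum_val l) => [[s c]|] //=.
  by rewrite -!natrM !mulnb.
case: (eqVneq (val r).1 (val r).2) => [E|ne].
  by rewrite (deltaE _ _ E erefl); apply: monomial_square_in_image.
rewrite (deltaE _ _ erefl erefl).
apply: (memv_eq (monomial_sym_in_image b ne)); apply/rowP=> l; rewrite !mxE.
case: (enum_val l) => [[s c]|]; last by rewrite addr0.
rewrite -[X in _ + X * _]natrM mulnb.
(* Index pairs are ordered and [r] has distinct entries, so no index is the swapped pair: the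
   symmetric sum is a single coordinate vector. *)
have -> : ((val s).1 == (val r).2) && ((val s).2 == (val r).1) = false.
  apply/negP=> /andP[/eqP s1 /eqP s2]; have /= := valP s; rewrite s1 s2 leq_eqVlt.
  rewrite val_eqE eq_sym (negPf ne) /= ltnNge.
  by have /= -> := valP r.
by rewrite mul0r addr0.
Qed.

Lemma dim_tangent_image_leq : (#|{: J}| <= \dim T)%N.
Proof.
rewrite -(limg_ker_dim (linfun (mulmxr M)) T) -/tangent_image tangent_image_full.
by rewrite dimvf dim_matrix [X in (_ + X)%N]mul1n leq_addl.
Qed.

End Image.

Lemma tangent_dim : (#|{: J}| <= \dim T)%N.
Proof. by have [M hM] := entry_functional; apply: (dim_tangent_image_leq hM). Qed.

End Tangent.

End TangentDimension.

(** * The minimal orbits *)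

Section SingularPoints.

Variables (F : numFieldType) (m : nat).
Local Notation n := m.+1.

Lemma Sing_Red_criterion (theta theta' : {linear 'M[F]_n -> 'M[F]_n}) p :
  (3 <= m)%N -> cancel theta theta' -> (forall y, \tr (theta y) = \tr y) ->
  (forall g, g \in unitmx -> exists2 g', g' \in unitmx & forall y,
    is_diag_mx (invmx g *m y *m g) -> is_diag_mx (invmx g' *m theta y *m g')) ->
  grassmannian m (sl F n) p -> (forall i, theta (nil_basis F i) \in p) ->
  Sing_Red p.
Proof.
move=> m3 thetaK theta_tr theta_diag gp nil_p.
have Rp := nil_in_Red thetaK theta_tr theta_diag gp nil_p.
split=> //.
have [T tanT] := @cone_tangent_space_exists F _ m (sl F n) (@Red F n) p.
have [d led ldim] := local_dimension_leq (@cartan_grassmannian F m) Rp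
  (fun l C => @Red_chain_bound F m p l C).
exists d, T; split=> //.
have := tangent_dim thetaK theta_tr theta_diag gp nil_p tanT.
rewrite card_tangent_index => leT; have leK := card_ordered_pair m.
apply/eqP; rewrite gtn_eqF //; apply: leq_trans leT; rewrite ltnS.
apply: leq_ltn_trans led _; rewrite -(ltn_pmul2l (isT : (0 < 2)%N)) mulnA.
(* What remains is 2 (1 + (m + 1)^2) < (m^2 + m) m, which reads 34 < 36 at m = 3 and is false at m =
   2. *)
apply: leq_trans (leq_mul leK (leqnn m)); move: m3; clear.
by nia.
Qed.

Lemma invmx_mul (g h : 'M[F]_n) : g \in unitmx -> h \in unitmx ->
  invmx (g *m h) = invmx h *m invmx g.
Proof. exact: (@invrM 'M[F]_n). Qed.

Lemma Sing_Red_conj (g : 'M[F]_n) p : (3 <= m)%N -> g \in unitmx ->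
  grassmannian m (sl F n) p ->
  (forall i, g *m nil_basis F i *m invmx g \in p) -> Sing_Red p.
Proof.
move=> m3 gu gp; apply: (Sing_Red_criterion (theta := mulmxr (invmx g) \o mulmx g)
  (theta' := mulmxr g \o mulmx (invmx g)) m3 _ _ _ gp) => [y|y|h hu] /=.
- exact: conjmxK.
- exact: trace_conj.
exists (g *m h) => [|y]; first by rewrite unitmx_mul gu.
by rewrite invmx_mul // !mulmxA mulmxKV // -(mulmxA _ (invmx g) g) mulVmx // mulmx1.
Qed.

(** If [h] diagonalises y, the inverse transpose of [h] diagonalises the transpose of y. *)
Lemma Sing_Red_conj_tr (g : 'M[F]_n) p : (3 <= m)%N -> g \in unitmx ->
  grassmannian m (sl F n) p ->
  (forall i, g *m (nil_basis F i)^T *m invmx g \in p) -> Sing_Red p.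
Proof.
move=> m3 gu gp; apply: (Sing_Red_criterion
  (theta := mulmxr (invmx g) \o mulmx g \o trmx)
  (theta' := trmx \o mulmxr g \o mulmx (invmx g)) m3 _ _ _ gp) => [y|y|h hu] /=.
- by rewrite conjmxK // trmxK.
- by rewrite trace_conj // mxtrace_tr.
exists (g *m invmx h^T) => [|y].
  by rewrite unitmx_mul gu unitmx_inv unitmx_tr.
rewrite invmx_mul ?unitmx_inv ?unitmx_tr // invmxK !mulmxA mulmxKV //.
rewrite -(mulmxA _ (invmx g) g) mulVmx // mulmx1 -trmx_inv -!trmx_mul mulmxA.
by move/is_diag_mxP => dy; apply/is_diag_mxP=> i j ij; rewrite mxE dy // eq_sym.
Qed.

(** * Frames adapted to a subspace *)

Lemma row_free_complete k (U B : 'M[F]_(k, n)) : row_free U -> row_free B ->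
  exists2 g, g \in unitmx & U *m g = B.
Proof.
move=> fU fB; have [|g gu hg] := @complete_unitmx _ _ _ U (pinvmx U *m B).
  by rewrite mulmxA mulmxVp // mul1mx (eqP fU) (eqP fB).
by exists g => //; rewrite -hg mulmxA mulmxVp // mul1mx.
Qed.

(** The basis of [V] is completed to one of the whole space; the work is done on transposes, where
    [U] picks out the rows indexed by [s]. *)
Lemma vspace_frame (V : {vspace 'cV[F]_n}) (s : 'I_(\dim V) -> 'I_n) :
  injective s -> exists2 g : 'M[F]_n, g \in unitmx &
    forall i, col (s i) g = (vbasis V)`_i.
Proof.
move=> inj_s.
pose U : 'M[F]_(\dim V, n) := \matrix_(i, j) (j == s i)%:R.
pose B := \matrix_(i < \dim V) ((vbasis V)`_i)^T.
have UE (A : 'M[F]_n) : U *m A = \matrix_(i < \dim V) row (s i) A.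
  apply/row_matrixP=> i; rewrite row_mul rowK (_ : row i U = delta_mx 0 (s i)) -?rowE //.
  by apply/rowP=> j; rewrite !mxE.
have fU : row_free U.
  apply: inj_row_free => v /rowP vU; apply/rowP=> i; have := vU (s i).
  rewrite !mxE (bigD1 i) //= !mxE eqxx mulr1 big1 ?addr0 // => j ji.
  by rewrite mxE (inj_eq inj_s) eq_sym (negPf ji) mulr0.
have fB : row_free B.
  apply: inj_row_free => v vB; apply/rowP=> i; rewrite mxE.
  have /freeP := basis_free (vbasisP V); apply.
  apply: trmx_inj; rewrite trmx0 -[RHS]vB mulmx_sum_row raddf_sum.
  by apply: eq_bigr => j _; rewrite rowK -linearZ.
have [g gu hg] := row_free_complete fU fB; exists g^T => [|i].
  by rewrite unitmx_tr.
have /(congr1 (row i)) := hg; rewrite UE !rowK => /(congr1 trmx).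
by rewrite trmxK tr_row.
Qed.

Lemma mem_vspace_frame (V : {vspace 'cV[F]_n}) (g : 'M[F]_n)
    (s : 'I_(\dim V) -> 'I_n) :
  injective s -> g \in unitmx -> (forall i, col (s i) g = (vbasis V)`_i) ->
  forall u, u \in V <-> forall a, a \notin codom s -> (invmx g *m u) a 0 = 0.
Proof.
move=> inj_s gu hg u; split=> [uV a as_|u0].
  rewrite (coord_vbasis uV) mulmx_sumr summxE big1 // => i _.
  rewrite -hg -scalemxAr colE mulKmx // !mxE; case: eqP => [ai|_]; last exact: mulr0.
  by rewrite ai codom_f in as_.
rewrite -[u](mulKVmx gu); move: (invmx g *m u) u0 => w w0.
have -> : w = \sum_i w (s i) 0 *: delta_mx (s i) 0.
  apply/colP=> a; rewrite summxE.
  have [/codomP[i ->]|/[dup] as_ /w0 ->] := boolP (a \in codom s).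
    rewrite (bigD1 i) //= !mxE !eqxx mulr1 big1 ?addr0 // => j ji.
    by rewrite !mxE (inj_eq inj_s) eq_sym (negPf ji) mulr0.
  rewrite big1 // => i _; rewrite !mxE; case: eqP => [ai|_]; last exact: mulr0.
  by rewrite ai codom_f in as_.
rewrite mulmx_sumr; apply: rpred_sum => i _; rewrite -scalemxAr -colE hg.
by apply/rpredZ/vbasis_mem/mem_nth; rewrite size_tuple.
Qed.

(** In the frame, having image in [V] kills the rows outside [S], and vanishing on [V] kills the
    columns in [S]. *)
Lemma mem_frak_a_frame (V : {vspace 'cV[F]_n}) (g : 'M[F]_n) (S : seq 'I_n) :
  g \in unitmx ->
  (forall u, u \in V <-> forall a, a \notin S -> (invmx g *m u) a 0 = 0) ->
  forall x, x \in frak_a V <->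
    forall a b, ~~ ((a \in S) && (b \notin S)) -> (invmx g *m x *m g) a b = 0.
Proof.
move=> gu hV x; set y := invmx g *m x *m g.
have yE u : invmx g *m (x *m u) = y *m (invmx g *m u).
  by rewrite /y -!mulmxA mulKVmx.
have ycol a b : y a b = (y *m delta_mx b 0 : 'cV_n) a 0 by rewrite -colE [RHS]mxE.
split=> [/mem_frak_a[im ker] a b|y0].
  rewrite negb_and negbK => /orP[aS|bS].
    have /hV/(_ a aS) := im (g *m delta_mx b 0).
    by rewrite yE mulKmx // -ycol.
  have /ker/(congr1 (mulmx (invmx g))) : g *m delta_mx b 0 \in V.
    apply/hV => c cS; rewrite mulKmx // mxE eqxx andbT.
    by case: eqP cS => // ->; rewrite bS.
  by rewrite yE mulKmx // mulmx0 ycol => ->; rewrite mxE.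
apply/mem_frak_a; split=> u.
  apply/hV => a aS; rewrite yE mxE big1 // => b _.
  by rewrite y0 ?mul0r // (negPf aS).
move=> /hV u0; rewrite -[LHS](mulKVmx gu) yE; set w := invmx g *m u.
suff -> : y *m w = 0 by rewrite mulmx0.
apply/colP=> a; rewrite !mxE big1 // => b _.
have [bS|/u0 ->] := boolP (b \in S); last exact: mulr0.
by rewrite y0 ?mul0r // bS andbF.
Qed.

Lemma nil_basisE i : nil_basis F i = delta_mx (ord0 : 'I_n) (lift (ord0 : 'I_n) i).
Proof.
have E1 (a b : 'I_m) : nil_basis F i (lift ord0 a) (lift ord0 b) = 0.
  by rewrite /nil_basis -!rshift1 (@block_mxEdr _ 1 m 1 m) mxE.
have E2 (b : 'I_m) : nil_basis F i ord0 (lift ord0 b) = (b == i)%:R.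
  by rewrite /nil_basis -!rshift1 (ord0_lshift m) (@block_mxEur _ 1 m 1 m) mxE.
have E3 (a : 'I_m) : nil_basis F i (lift ord0 a) ord0 = 0.
  by rewrite /nil_basis -!rshift1 (ord0_lshift m) (@block_mxEdl _ 1 m 1 m) mxE.
have E4 : nil_basis F i ord0 ord0 = 0.
  by rewrite /nil_basis (ord0_lshift m) (@block_mxEul _ 1 m 1 m) mxE.
apply/matrixP=> a b; rewrite [RHS]mxE.
case: (unliftP ord0 a) => [a'|] ->; case: (unliftP ord0 b) => [b'|] ->.
- by have -> := E1 a' b'; rewrite eq_sym (negPf (neq_lift _ _)).
- by have -> := E3 a'; rewrite eq_sym (negPf (neq_lift _ _)).
- by have -> := E2 b'; rewrite (inj_eq lift_inj).
- by rewrite E4 andbC (negPf (neq_lift _ _)).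
Qed.

Lemma conj_span_grassmannian (A : {vspace 'M[F]_n}) g (N : 'I_m -> 'M[F]_n) :
  g \in unitmx -> (forall i, \tr (N i) = 0) ->
  (forall c, \sum_i c i *: N i = 0 -> forall i, c i = 0) ->
  (forall x, x \in A <-> exists c, invmx g *m x *m g = \sum_i c i *: N i) ->
  grassmannian m (sl F n) A /\ forall i, g *m N i *m invmx g \in A.
Proof.
move=> gu trN freeN hA.
have conj_sum c : \sum_i c i *: (g *m N i *m invmx g) =
    g *m (\sum_i c i *: N i) *m invmx g.
  rewrite mulmx_sumr mulmx_suml; apply: eq_bigr => i _.
  by rewrite -scalemxAr -scalemxAl.
have NA i : g *m N i *m invmx g \in A.
  apply/hA; exists (fun j => (j == i)%:R); rewrite conjmxK //.
  rewrite (bigD1 i) //= eqxx scale1r big1 ?addr0 // => j /negPf ->.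
  exact: scale0r.
split=> //; split.
  apply/subvP=> x /hA[c xE]; rewrite mem_sl -(trace_conjV x gu) xE raddf_sum /=.
  by rewrite big1 // => i _; rewrite mxtraceZ trN mulr0.
apply: (dim_lincomb NA) => [x /hA[c xE]|c c0].
  by exists c; rewrite conj_sum -xE conjmxVK.
by apply: freeN; rewrite -[LHS](conjmxK _ gu) -conj_sum c0 mulmx0 mul0mx.
Qed.

Lemma Sing_Red_Omin' (A : {vspace 'M[F]_n}) : (3 <= m)%N -> Omin' A -> Sing_Red A.
Proof.
move=> m3 [V dimV ->].
(* [V] is spanned by column 0 of the frame, so [frak_a V] becomes row 0 without its diagonal entry,
   the span of [nil_basis]. *)
pose s (i : 'I_(\dim V)) : 'I_n := ord0.
have inj_s : injective s.
  by move=> i j _; apply: val_inj; move: i j; rewrite dimV => i j; rewrite !ord1.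
have [g gu hg] := vspace_frame inj_s.
have codom_s a : (a \in codom s) = (a == ord0).
  apply/codomP/eqP=> [[i ->]//|->].
  have lt0 : (0 < \dim V)%N by rewrite dimV.
  by exists (Ordinal lt0).
have hfa := mem_frak_a_frame (S := codom s) gu (mem_vspace_frame inj_s gu hg).
have [|||gA NA] := @conj_span_grassmannian (frak_a V) g (fun i => nil_basis F i) gu.
- exact: trace_nil_basis.
- move=> c /matrixP c0 i; have := c0 ord0 (lift ord0 i); rewrite summxE mxE.
  rewrite (bigD1 i) //= nil_basisE !mxE !eqxx mulr1 big1 ?addr0 // => j ji.
  by rewrite nil_basisE !mxE (inj_eq lift_inj) eq_sym (negPf ji) andbF mulr0.
- move=> x; apply: (iff_trans (hfa x)); move: (_ *m _ *m _) => y.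
  split=> [y0|[c ->] a b].
    exists (fun i => y ord0 (lift ord0 i)); apply/matrixP=> a b; rewrite summxE.
    case: (unliftP ord0 b) => [b'|] ->; last first.
      rewrite y0 ?codom_s ?eqxx ?andbF // big1 // => i _.
      by rewrite nil_basisE !mxE andbF mulr0.
    rewrite (bigD1 b') //= nil_basisE !mxE eqxx andbT big1 ?addr0 => [|i ib].
      case: eqP => [->|/eqP a0]; first by rewrite mulr1.
      by rewrite mulr0 y0 // codom_s (negPf a0).
    by rewrite nil_basisE !mxE (inj_eq lift_inj) [b' == i]eq_sym (negPf ib) andbF mulr0.
  rewrite -[b \in _]negbK !codom_s => ab; rewrite summxE big1 // => i _.
  rewrite nil_basisE !mxE; case: eqP => [a0|_]; last exact: mulr0.
  by case: eqP => [b0|_]; [rewrite a0 b0 in ab|exact: mulr0].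
exact: Sing_Red_conj gA NA.
Qed.

Lemma Sing_Red_Omin'' (A : {vspace 'M[F]_n}) : (3 <= m)%N -> Omin'' A -> Sing_Red A.
Proof.
move=> m3 [V dimV ->].
(* [V] is spanned by the columns other than 0, so [frak_a V] becomes column 0 without its diagonal
   entry, the span of the transposes. *)
pose s (i : 'I_(\dim V)) : 'I_n := lift ord0 (cast_ord dimV i).
have inj_s : injective s by move=> i j /lift_inj/cast_ord_inj.
have [g gu hg] := vspace_frame inj_s.
have codom_s a : (a \in codom s) = (a != ord0).
  apply/codomP/idP=> [[i ->]|]; first by rewrite eq_sym neq_lift.
  case: (unliftP ord0 a) => [a' ->|->]; last by rewrite eqxx.
  by exists (cast_ord (esym dimV) a'); rewrite /s cast_ordKV.
have hfa := mem_frak_a_frame (S := codom s) gu (mem_vspace_frame inj_s gu hg).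
have [|||gA NA] := @conj_span_grassmannian (frak_a V) g (fun i => (nil_basis F i)^T) gu.
- by move=> i; rewrite mxtrace_tr trace_nil_basis.
- move=> c /matrixP c0 i; have := c0 (lift ord0 i) ord0; rewrite summxE mxE.
  rewrite (bigD1 i) //= nil_basisE !mxE !eqxx mulr1 big1 ?addr0 // => j ji.
  by rewrite nil_basisE !mxE (inj_eq lift_inj) eq_sym (negPf ji) andbF mulr0.
- move=> x; apply: (iff_trans (hfa x)); move: (_ *m _ *m _) => y.
  split=> [y0|[c ->] a b].
    exists (fun i => y (lift ord0 i) ord0); apply/matrixP=> a b; rewrite summxE.
    case: (unliftP ord0 a) => [a'|] ->; last first.
      rewrite y0 ?codom_s ?eqxx // big1 // => i _.
      by rewrite nil_basisE !mxE andbF mulr0.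
    rewrite (bigD1 a') //= nil_basisE !mxE eqxx andbT big1 ?addr0 => [|i ia].
      case: eqP => [->|/eqP b0]; first by rewrite mulr1.
      by rewrite mulr0 y0 // !codom_s b0 andbF.
    by rewrite nil_basisE !mxE (inj_eq lift_inj) [a' == i]eq_sym (negPf ia) andbF mulr0.
  rewrite !codom_s negbK => ab; rewrite summxE big1 // => i _.
  rewrite nil_basisE !mxE; case: eqP => [b0|_]; last exact: mulr0.
  by case: eqP => [a0|_]; [rewrite a0 b0 in ab|exact: mulr0].
exact: Sing_Red_conj_tr gA NA.
Qed.

End SingularPoints.

Theorem proposition11 (R : realType) (n : nat) (hn : (4 <= n)%N) :
  (forall A : {vspace 'M[R[i]]_n}, Omin' A -> Sing_Red A) /\
  (forall A : {vspace 'M[R[i]]_n}, Omin'' A -> Sing_Red A).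
Proof.
case: n hn => [//|m] m3.
by split=> A; [apply: (@Sing_Red_Omin' R[i])|apply: (@Sing_Red_Omin'' R[i])].
Qed.
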